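(* Let $\Omega\subset\mathbb R^d$ be open, $\omega\in\mathcal W$, and let $h=[(h_\varepsilon)]\in\mathcal G^{\{\omega\}}(\Omega)$. If there exists $\omega_1\in\mathcal W$ with $\omega_1\ll\omega$ such that for all $\rho\in\mathcal D^{(\omega_1)}(\Omega)$ $$[(\langle h_\varepsilon,\rho\rangle)]=0\quad\text{in }\tilde{\mathbb C}^{\{\omega\}},$$ then $h=0$.
   Context: $\mathbb R^+=[0,\infty)$. $\mathcal W$ is the set of all nondecreasing continuous functions $\omega:\mathbb R^+\to\mathbb R^+$ such that $\omega(0)=0$; $\omega(x+y)\le\omega(x)+\omega(y)$ for all $x,y\ge 0$; $\int_1^\infty \frac{\omega(t)}{t^2}\,dt<\infty$; and $\lim_{t\to\infty}\frac{\omega(t)}{\log(1+t)}=\infty$. For $\omega_1,\omega_2\in\mathcal W$, $\omega_1\ll\omega_2$ means $\omega_1(t)=o(\omega_2(t))$ as $t\to\infty$. For a compactly supported continuous $f$ on $\mathbb R^d$, $\sigma\in\mathcal W$ and $l>0$: $\|f\|_l^{\sigma}=\int|\hat f(\xi)|e^{l\sigma(|\xi|)}d\xi\in[0,\infty]$. $\mathcal D^{(\sigma)}(\Omega)$ (resp. $\mathcal D^{\{\sigma\}}(\Omega)$) is the set of continuous $f$ with compact support in $\Omega$ and $\|f\|_l^\sigma<\infty$ for all $l>0$ (resp. for some $l>0$). $\mathcal E^{\{\omega\}}(\Omega)$ is the set of smooth $f:\Omega\to\mathbb C$ with $\psi f\in\mathcal D^{\{\omega\}}(\Omega)$ for all $\psi\in\mathcal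 D^{\{\omega\}}(\Omega)$; for compact $K\subset\Omega$, $\|f\|_{K,l}^{\omega}=\inf\{\|\psi f\|_l^{\omega}:\psi\in\mathcal D^{\{\omega\}}(\Omega),\ \psi=1\text{ on }K\}$. Nets in $\mathcal E^{\{\omega\}}(\Omega)$ are indexed by $\varepsilon\in(0,1)$, $o(\cdot)$ is as $\varepsilon\to0^+$, $K$ ranges over compact subsets of $\Omega$. Moderate: $\forall K\,\forall k>0\,\exists h>0$: $\|g_\varepsilon\|_{K,h}^\omega=o(e^{k\omega(1/\varepsilon)})$. Negligible: $\forall K\,\exists k>0\,\exists h>0$: $\|g_\varepsilon\|_{K,h}^\omega=o(e^{-k\omega(1/\varepsilon)})$. $\mathcal G^{\{\omega\}}(\Omega)$ is the quotient of moderate by negligible nets. $\langle h_\varepsilon,\rho\rangle=\int h_\varepsilon\rho$, and $[(r_\varepsilon)]=0$ in $\tilde{\mathbb C}^{\{\omega\}}$ means $|r_\varepsilon|=o(e^{-l\omega(1/\varepsilon)})$ for some $l>0$. *)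

(* Defs.v *)
From HB Require Import structures.
From mathcomp Require Import all_boot all_order all_algebra.
From mathcomp Require Import all_classical all_reals all_analysis.
From mathcomp Require Import complex.

Set Implicit Arguments.
Unset Strict Implicit.
Unset Printing Implicit Defensive.
Import Order.TTheory GRing.Theory Num.Theory.
Import numFieldNormedType.Exports.
Local Open Scope classical_set_scope.
Local Open Scope ring_scope.

(* Lebesgue measure on R^d, with R^d as a d-fold product measurable space
   (d.-tuple R): by induction on d, lambda^0 is the Dirac mass on the one-point
   space and lambda^(d+1) is the image of lambda^1 \x lambda^d by cons. *)
Section lebesgue_measure_tuple.
Context {R : realType}.
Local Notation RM := (measurableTypeR R).

Definition cons_pair n (p : RM * n.-tuple RM) : n.+1.-tuple RM :=
  [tuple of p.1 :: p.2].

Lemma measurable_cons_pair n : measurable_fun setT (@cons_pair n).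
Proof. exact: measurable_cons. Qed.

Section cons_measure.
Variables (d : nat) (m1 : {sigma_finite_measure set RM -> \bar R})
  (m2 : {sigma_finite_measure set (d.-tuple RM) -> \bar R}).

Definition cons_measure : set (d.+1.-tuple RM) -> \bar R :=
  pushforward (m1 \x m2)%E (@cons_pair d).

Let cons_measure0 : cons_measure set0 = 0%E.
Proof. by rewrite /cons_measure /pushforward preimage_set0 measure0. Qed.

Let cons_measure_ge0 A : (0 <= cons_measure A)%E.
Proof. by rewrite /cons_measure /pushforward; exact: measure_ge0. Qed.

Let cons_measure_sigma_additive : semi_sigma_additive cons_measure.
Proof.
move=> F mF tF mUF; rewrite /cons_measure /pushforward preimage_bigcup.
have mc := @measurable_cons_pair d.
apply: measure_semi_sigma_additive.
- by move=> n; rewrite -[X in measurable X]setTI; exact: mc.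
- apply/trivIsetP => /= i j _ _ ij; rewrite -preimage_setI.
  by move/trivIsetP : tF => /(_ _ _ _ _ ij) ->//; rewrite preimage_set0.
- by rewrite -preimage_bigcup -[X in measurable X]setTI; exact: mc.
Qed.

HB.instance Definition _ := isMeasure.Build _ _ _ cons_measure
  cons_measure0 cons_measure_ge0 cons_measure_sigma_additive.

Let cons_measure_sigma_finite : sigma_finite setT cons_measure.
Proof.
have /sigma_finiteP[F [FT ndF Foo]] := sigma_finiteT m1.
have /sigma_finiteP[G [GT ndG Goo]] := sigma_finiteT m2.
pose uncons (t : d.+1.-tuple RM) : RM * d.-tuple RM :=
  (thead t, [tuple of behead t]).
have cK : cancel (@cons_pair d) uncons.
  by move=> [x t]; rewrite /uncons theadE; congr (_, _); exact: val_inj.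
have mh : measurable_fun setT (fun t : d.+1.-tuple RM => thead t).
  exact: measurable_tnth.
have mb := @measurable_behead _ RM d.
exists (fun n => uncons @^-1` (F n `*` G n)).
  apply/seteqP; split=> // t _.
  have [n _ Fn] : (\bigcup_i F i) (thead t) by rewrite -FT.
  have [k _ Gk] : (\bigcup_i G i) [tuple of behead t] by rewrite -GT.
  exists (maxn n k) => //; split => /=.
  - by move: Fn; exact/subsetPset/ndF/leq_maxl.
  - by move: Gk; exact/subsetPset/ndG/leq_maxr.
move=> n; have [mF F_lty] := Foo n; have [mG G_lty] := Goo n; split.
  rewrite (_ : uncons @^-1` _ = (setT `&` (fun t : d.+1.-tuple RM => thead t) @^-1` F n) `&`
    (setT `&` (fun t : d.+1.-tuple RM => [tuple of behead t]) @^-1` G n)); last first.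
    by rewrite !setTI; apply/seteqP; split.
  by apply: measurableI; [exact: mh|exact: mb].
rewrite /cons_measure /pushforward -comp_preimage.
rewrite (_ : uncons \o _ = id); last exact/funext.
by rewrite preimage_id product_measure1E// lte_mul_pinfty// ge0_fin_numE.
Qed.

HB.instance Definition _ := @Measure_isSigmaFinite.Build _ _ _ cons_measure
  cons_measure_sigma_finite.

End cons_measure.

Fixpoint lebesgue_tuple (d : nat) :
    {sigma_finite_measure set (d.-tuple RM) -> \bar R} :=
  match d with
  | 0 => \d_([tuple] : 0.-tuple RM)
  | d'.+1 => cons_measure lebesgue_measure (lebesgue_tuple d')
  end.

End lebesgue_measure_tuple.

Section euclidean_space.
Context {R : realType} {d : nat}.
Implicit Types (x xi : 'rV[R]_d) (f : 'rV[R]_d -> R[i]).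

Definition row_of_tuple (t : d.-tuple (measurableTypeR R)) : 'rV[R]_d :=
  \row_i tnth t i.

Definition eintegral (F : 'rV[R]_d -> \bar R) : \bar R :=
  (\int[lebesgue_tuple d]_t F (row_of_tuple t))%E.

Definition rintegral (F : 'rV[R]_d -> R) : R :=
  \int[lebesgue_tuple d]_t F (row_of_tuple t).

Definition cintegral f : R[i] :=
  Complex (rintegral (fun x => complex.Re (f x)))
          (rintegral (fun x => complex.Im (f x))).

Definition dotp x xi : R := \sum_i x 0 i * xi 0 i.

(* The norm of 'rV[R]_d in the library is the sup norm. *)
Definition euclid xi : R := Num.sqrt (dotp xi xi).

Definition cis (t : R) : R[i] := Complex (cos t) (sin t).

Definition fourier f xi : R[i] :=
  cintegral (fun x => f x * cis (- dotp x xi)).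

Definition ccontinuous f : Prop :=
  continuous (fun x => complex.Re (f x)) /\
  continuous (fun x => complex.Im (f x)).

Definition csupport f : set 'rV[R]_d := closure [set x | f x != 0].

(* All iterated partial derivatives up to order n exist and are continuous on
   the set Omega, which is meant to be open: then only the values of F on Omega
   matter. *)
Fixpoint Cn_on (n : nat) (Omega : set 'rV[R]_d) (F : 'rV[R]_d -> R) : Prop :=
  (forall x, Omega x -> {for x, continuous F}) /\
  match n with
  | 0 => True
  | n'.+1 => forall i : 'I_d,
      (forall x, Omega x -> derivable F x (delta_mx 0 i)) /\
      Cn_on n' Omega ('D_(delta_mx 0 i) F)
  end.

Definition smooth_on (Omega : set 'rV[R]_d) f : Prop :=
  forall n, Cn_on n Omega (fun x => complex.Re (f x)) /\
            Cn_on n Omega (fun x => complex.Im (f x)).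

End euclidean_space.

(* f = o(g) along F; f may be infinite, so that the library's littleo, which is
   about maps between normed modules, does not apply. *)
Definition is_littleo {R : realType} (F : set_system R) (f : R -> \bar R)
    (g : R -> R) : Prop :=
  forall c, 0 < c -> \forall x \near F, (`|f x| <= (c * `|g x|)%:E)%E.

Section weights.
Context {R : realType}.
Implicit Types omega sigma : R -> R.

(* A weight is a function on [0, +oo[; values at negative arguments are
   irrelevant. *)
Record weight omega : Prop := Weight {
  weight_ge0 : forall t, 0 <= t -> 0 <= omega t ;
  weight_nd : forall s t, 0 <= s -> s <= t -> omega s <= omega t ;
  weight_cont : {within `[0, +oo[, continuous omega} ;
  weight0 : omega 0 = 0 ;
  weight_subadd : forall s t, 0 <= s -> 0 <= t ->
    omega (s + t) <= omega s + omega t ;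
  weight_int : (\int[lebesgue_measure]_(t in `[1%R, +oo[)
    (omega t / t ^+ 2)%:E < +oo)%E ;
  weight_log : omega t / ln (1 + t) @[t --> +oo] --> +oo
}.

Definition weight_ll (omega1 omega2 : R -> R) : Prop :=
  is_littleo +oo (EFin \o omega1) omega2.

End weights.

Section ultradifferentiable.
Context {R : realType} {d : nat}.
Implicit Types (omega sigma : R -> R) (f : 'rV[R]_d -> R[i]).
Implicit Types (Omega K : set 'rV[R]_d).

Definition fnorm sigma (l : R) f : \bar R :=
  eintegral (fun xi =>
    (Normc.normc (fourier f xi) * expR (l * sigma (euclid xi)))%:E).

Definition Cc Omega f : Prop :=
  [/\ ccontinuous f, compact (csupport f) & csupport f `<=` Omega].

Definition Dbeurling sigma Omega f : Prop :=
  Cc Omega f /\ forall l, 0 < l -> (fnorm sigma l f < +oo)%E.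

Definition Droumieu sigma Omega f : Prop :=
  Cc Omega f /\ exists2 l, 0 < l & (fnorm sigma l f < +oo)%E.

(* Functions on Omega are represented by total functions whose values outside
   Omega are irrelevant: if psi is supported in Omega, then psi * f is the
   extension by zero of the product on Omega. *)
Definition Eroumieu omega Omega f : Prop :=
  smooth_on Omega f /\
  forall psi, Droumieu omega Omega psi ->
    Droumieu omega Omega (fun x => psi x * f x).

Definition fnorm_on omega Omega K (l : R) f : \bar R :=
  ereal_inf [set fnorm omega l (fun x => psi x * f x) | psi in
    [set psi | Droumieu omega Omega psi /\ forall x, K x -> psi x = 1]].

End ultradifferentiable.

Section generalized_functions.
Context {R : realType} {d : nat}.
Implicit Types (omega : R -> R) (Omega K : set 'rV[R]_d).
Implicit Types g h : R -> 'rV[R]_d -> R[i].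

(* Nets are indexed by 0 < eps < 1; other values of eps are irrelevant. *)
Definition Enet omega Omega g : Prop :=
  forall eps, 0 < eps < 1 -> Eroumieu omega Omega (g eps).

Definition moderate omega Omega g : Prop :=
  Enet omega Omega g /\
  forall K, compact K -> K `<=` Omega -> forall k, 0 < k ->
    exists2 h, 0 < h &
      is_littleo 0^'+ (fun eps => fnorm_on omega Omega K h (g eps))
                      (fun eps => expR (k * omega eps^-1)).

Definition negligible_net omega Omega g : Prop :=
  Enet omega Omega g /\
  forall K, compact K -> K `<=` Omega ->
    exists2 k, 0 < k & exists2 h, 0 < h &
      is_littleo 0^'+ (fun eps => fnorm_on omega Omega K h (g eps))
                      (fun eps => expR (- (k * omega eps^-1))).

(* Equality, in the quotient of moderate nets by negligible nets, of the
   classes of the moderate nets g and h. *)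
Definition Geq omega Omega g h : Prop :=
  negligible_net omega Omega (fun eps x => g eps x - h eps x).

Definition pairing (f rho : 'rV[R]_d -> R[i]) : R[i] :=
  cintegral (fun x => f x * rho x).

(* The class of the net of complex numbers r is 0. *)
Definition cnet_zero omega (r : R -> R[i]) : Prop :=
  exists2 l, 0 < l &
    is_littleo 0^'+ (fun eps => (Normc.normc (r eps))%:E)
                    (fun eps => expR (- (l * omega eps^-1))).

End generalized_functions.

(* Main.v *)
From HB Require Import structures.
Require Import Defs.
From mathcomp Require Import all_boot all_order all_algebra.
From mathcomp Require Import all_classical all_reals all_analysis.
From mathcomp Require Import complex measurable_realfun ring lra.

(** The hypothesis on the pairings is qualitative: the exponent l depends on the
test function. A uniform boundedness argument makes it quantitative, and the
moderateness of h then turns a bound on Fourier transforms that is only small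
up to subexponential growth into a bound on the norms.

Fix a compact K. Moderateness says that an infimum over the functions psi of
class omega, equal to 1 on K, is finite; hence there is such a psi, and since
omega1 << omega it belongs to the smaller class of test functions for omega1,
together with all its products with characters x |-> e^{-i x.xi}. The Fourier
transform of psi h_eps at xi is the pairing of h_eps with such a product.
A gliding hump ([gliding_hump]) over superpositions of these products gives an
n such that, for small eps and all xi,
   |F(psi h_eps)(xi)| <= 2 e^{n omega1|xi|} e^{-l omega(1/eps)},  l = 1/(n+1)
([fourier_uniform_bound]).

On the other side, moderateness on the support of psi, with k = l/2, gives for
each small eps a psi_eps, equal to 1 on this support, such that the norm of
psi_eps h_eps is O(e^{(l/2) omega(1/eps)}). As psi h_eps = psi (psi_eps h_eps),
the same holds for psi h_eps because multiplication by the fixed function psi is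
bounded for the weighted norms ([fnorm_mul]). The last point rests on Fourier
inversion ([fourier_inversion]): psi is itself a superposition of characters,
whose density is its Fourier transform, and a superposition of characters acts
on norms through translations ([fnorm_superpose]), for which subadditive weights
are made. Interpolating between the two bounds ([fnorm_interpolation]), by means
of the integrability of e^{n omega1 - a omega}, gives norms that are
O(e^{-(l/4) omega(1/eps)}).

One lemma thus serves three times: [fourier_superpose] computes the Fourier
transform of a product with a superposition of characters by Fubini, for
countable superpositions (the gliding hump), for psi itself (multiplication),
and for the damped integrals from which the inversion formula is obtained. *)

Set Implicit Arguments.
Unset Strict Implicit.
Unset Printing Implicit Defensive.
Import Order.TTheory GRing.Theory Num.Theory.
Import numFieldNormedType.Exports.
Local Open Scope classical_set_scope.
Local Open Scope ring_scope.

(** * Complex numbers and complex integrals *)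

Section complex_numbers.
Context {R : realType}.
Implicit Types z w : R[i].
Local Notation normc := Normc.normc.

Lemma Re_mulc z w : complex.Re (z * w) =
  complex.Re z * complex.Re w - complex.Im z * complex.Im w.
Proof. by case: z w => [a b] [c d]. Qed.

Lemma Im_mulc z w : complex.Im (z * w) =
  complex.Re z * complex.Im w + complex.Im z * complex.Re w.
Proof. by case: z w => [a b] [c d]. Qed.

Lemma Re_subc z w : complex.Re (z - w) = complex.Re z - complex.Re w.
Proof. by case: z w => [a b] [c d]. Qed.

Lemma Im_subc z w : complex.Im (z - w) = complex.Im z - complex.Im w.
Proof. by case: z w => [a b] [c d]. Qed.

Lemma normcE z : normc z = Num.sqrt (complex.Re z ^+ 2 + complex.Im z ^+ 2).
Proof. by case: z. Qed.

Lemma normc_ge0 z : 0 <= normc z.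
Proof. by rewrite normcE sqrtr_ge0. Qed.

Lemma Re_le_normc z : `|complex.Re z| <= normc z.
Proof. by rewrite normcE -sqrtr_sqr ler_wsqrtr// lerDl sqr_ge0. Qed.

Lemma Im_le_normc z : `|complex.Im z| <= normc z.
Proof. by rewrite normcE -sqrtr_sqr ler_wsqrtr// lerDr sqr_ge0. Qed.

Lemma normc_le_add z : normc z <= `|complex.Re z| + `|complex.Im z|.
Proof.
rewrite normcE -[leRHS]ger0_norm ?addr_ge0// -sqrtr_sqr ler_wsqrtr//.
rewrite sqrrD !real_normK ?num_real// addrAC lerDl.
by rewrite mulrn_wge0// mulr_ge0.
Qed.

Lemma normc_real (r : R) : normc r%:C%C = `|r|.
Proof. by rewrite normcE /= expr0n /= addr0 sqrtr_sqr. Qed.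

Lemma normc_cis (t : R) : normc (cis t) = 1.
Proof. by rewrite normcE /= cos2Dsin2 sqrtr1. Qed.

Lemma cis0 : cis (0 : R) = 1.
Proof. by rewrite /cis cos0 sin0. Qed.

Lemma cisD (s t : R) : cis (s + t) = cis s * cis t.
Proof. by apply/eqP; rewrite eq_complex /= cosD sinD eqxx /= addrC eqxx. Qed.

End complex_numbers.

Section complex_integral.
Context {R : realType}.
Local Notation normc := Normc.normc.

Definition cmeas d (T : measurableType d) (f : T -> R[i]) :=
  measurable_fun setT (fun x => complex.Re (f x)) /\
  measurable_fun setT (fun x => complex.Im (f x)).

Definition cL1 d (T : measurableType d) (mu : {measure set T -> \bar R})
    (f : T -> R[i]) :=
  cmeas f /\ (\int[mu]_x (normc (f x))%:E < +oo)%E.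

Definition cint d (T : measurableType d) (mu : {measure set T -> \bar R})
    (f : T -> R[i]) : R[i] :=
  Complex (\int[mu]_x complex.Re (f x)) (\int[mu]_x complex.Im (f x)).

Section measurability.
Context d (T : measurableType d).
Implicit Types f g : T -> R[i].

Lemma cmeasM f g : cmeas f -> cmeas g -> cmeas (fun x => f x * g x).
Proof.
move=> [fr fi] [gr gi]; split.
  under eq_fun do rewrite Re_mulc.
  by apply: measurable_funB; apply: measurable_funM.
under eq_fun do rewrite Im_mulc.
by apply: measurable_funD; apply: measurable_funM.
Qed.

Lemma cmeas_normc f : cmeas f -> measurable_fun setT (fun x => normc (f x)).
Proof.
move=> [fr fi]; under eq_fun do rewrite normcE.
apply: (@measurableT_comp _ _ _ _ _ _ (@Num.sqrt R)).
  by apply: continuous_measurable_fun; exact: sqrt_continuous.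
by apply: measurable_funD; apply: measurable_funX.
Qed.

Lemma cmeas_comp d' (S : measurableType d') f (p : S -> T) :
  cmeas f -> measurable_fun setT p -> cmeas (f \o p).
Proof. by move=> [fr fi] mp; split; [exact: (measurableT_comp fr mp)|exact: (measurableT_comp fi mp)]. Qed.

Lemma cmeas_cis (p : T -> R) : measurable_fun setT p ->
  cmeas (fun x => cis (p x)).
Proof.
move=> mp; split => /=.
  apply: (@measurableT_comp _ _ _ _ _ _ (@cos R)) => //.
  apply: continuous_measurable_fun; exact: continuous_cos.
apply: (@measurableT_comp _ _ _ _ _ _ (@sin R)) => //.
apply: continuous_measurable_fun; exact: continuous_sin.
Qed.

Lemma cmeas_real (p : T -> R) : measurable_fun setT p ->
  cmeas (fun x => (p x)%:C%C).
Proof. by split. Qed.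

End measurability.

Section integrability.
Context d (T : measurableType d) (mu : {measure set T -> \bar R}).
Implicit Types f g : T -> R[i].

Lemma cL1_Re f : cL1 mu f -> mu.-integrable setT (fun x => (complex.Re (f x))%:E).
Proof.
move=> [[mr mi] fi]; apply/integrableP; split; first exact/measurable_EFinP.
apply: le_lt_trans fi; apply: ge0_le_integral => //=.
- by apply/measurable_EFinP; exact: measurableT_comp.
- by apply/measurable_EFinP; exact: cmeas_normc.
- by move=> x _; rewrite lee_fin Re_le_normc.
Qed.

Lemma cL1_Im f : cL1 mu f -> mu.-integrable setT (fun x => (complex.Im (f x))%:E).
Proof.
move=> [[mr mi] fi]; apply/integrableP; split; first exact/measurable_EFinP.
apply: le_lt_trans fi; apply: ge0_le_integral => //=.
- by apply/measurable_EFinP; exact: measurableT_comp.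
- by apply/measurable_EFinP; exact: cmeas_normc.
- by move=> x _; rewrite lee_fin Im_le_normc.
Qed.

Lemma cL1_le f (g : T -> R) : cmeas f -> measurable_fun setT g ->
  (forall x, normc (f x) <= g x) -> (\int[mu]_x (g x)%:E < +oo)%E -> cL1 mu f.
Proof.
move=> mf mg fg gi; split => //; apply: le_lt_trans gi.
apply: ge0_le_integral => //=.
- by move=> x _; rewrite lee_fin normc_ge0.
- by apply/measurable_EFinP; exact: cmeas_normc.
- exact/measurable_EFinP.
- by move=> x _; rewrite lee_fin.
Qed.

(** Bounding the real and the imaginary part separately costs a factor 2, which is
harmless because constants never matter in the sequel. *)
Lemma normc_cint f : cL1 mu f ->
  ((normc (cint mu f))%:E <= 2%:E * \int[mu]_x (normc (f x))%:E)%E.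
Proof.
move=> fL; have [mf fi] := fL.
have h (g : T -> R) : mu.-integrable setT (EFin \o g) ->
    (forall x, `|g x| <= normc (f x)) ->
    (`|\int[mu]_x g x|%:E <= \int[mu]_x (normc (f x))%:E)%E.
  move=> ig gf; rewrite EFin_normr_Rintegral//.
  apply: le_trans (le_abse_integral _ _ _) _ => //.
    by case/integrableP : ig => [? ?].
  apply: ge0_le_integral => //=.
  - case/integrableP : ig => /measurable_EFinP mg _.
    by apply/measurable_EFinP; exact: measurableT_comp.
  - by apply/measurable_EFinP; exact: cmeas_normc.
  - by move=> x _; rewrite lee_fin.
rewrite (_ : 2%:E = 1%:E + 1%:E)%E; last by rewrite -EFinD.
rewrite ge0_muleDl ?lee_fin// mul1e.
apply: (@le_trans _ _ ((`|complex.Re (cint mu f)| + `|complex.Im (cint mu f)|)%:E)).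
  by rewrite lee_fin normc_le_add.
rewrite EFinD; apply: leeD.
  by apply: h => [|x]; [exact: cL1_Re|exact: Re_le_normc].
by apply: h => [|x]; [exact: cL1_Im|exact: Im_le_normc].
Qed.

Lemma cL1Z f (c : R[i]) : cL1 mu f -> cL1 mu (fun x => c * f x).
Proof.
move=> [mf fi]; split; first by apply: (@cmeasM _ _ (fun=> c) f).
under eq_integral do rewrite Normc.normcM EFinM.
rewrite ge0_integralZl//=; first by rewrite lte_mul_pinfty// lee_fin normc_ge0.
- by apply/measurable_EFinP; exact: cmeas_normc.
- by move=> x _; rewrite lee_fin normc_ge0.
- by rewrite lee_fin normc_ge0.
Qed.

Lemma cintZ f (c : R[i]) : cL1 mu f ->
  cint mu (fun x => c * f x) = c * cint mu f.
Proof.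
move=> fL; have fr := cL1_Re fL; have fi := cL1_Im fL.
have Zl (g : T -> R) (r : R) : mu.-integrable setT (EFin \o g) ->
    mu.-integrable setT (fun x => (r * g x)%:E).
  by move=> ig; under eq_fun do rewrite EFinM; exact: integrableZl.
apply/eqP; rewrite eq_complex Re_mulc Im_mulc /=; apply/andP; split; apply/eqP.
  under eq_Rintegral do rewrite Re_mulc.
  by rewrite RintegralB ?RintegralZl//; exact: Zl.
under eq_Rintegral do rewrite Im_mulc.
by rewrite RintegralD ?RintegralZl//; exact: Zl.
Qed.

Lemma eq_cint f g : f =1 g -> cint mu f = cint mu g.
Proof. by move=> /funext ->. Qed.

End integrability.

Section fubini.
Context d1 d2 (T1 : measurableType d1) (T2 : measurableType d2).
Variables (m1 : {sigma_finite_measure set T1 -> \bar R})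
  (m2 : {sigma_finite_measure set T2 -> \bar R}).

Lemma measurable_Rintegral_pair (F : T1 * T2 -> R) : measurable_fun setT F ->
  measurable_fun setT (fun x => \int[m2]_y F (x, y)).
Proof.
move=> mF; rewrite /Rintegral; under eq_fun do rewrite integralE.
have mE : measurable_fun setT (EFin \o F) by exact/measurable_EFinP.
apply: measurableT_comp; first exact: fine_measurable.
apply: emeasurable_funB.
  rewrite (_ : (fun x => _) = fubini_F m2 (EFin \o F)^\+%E).
    by apply: measurable_fun_fubini_tonelli_F => //; exact: measurable_funepos.
  by apply/funext => x; apply: eq_integral => y _; rewrite !funeposE.
rewrite (_ : (fun x => _) = fubini_F m2 (EFin \o F)^\-%E).
  by apply: measurable_fun_fubini_tonelli_F => //; exact: measurable_funeneg.
by apply/funext => x; apply: eq_integral => y _; rewrite !funenegE.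
Qed.

Lemma cmeas_cint_pair (F : T1 * T2 -> R[i]) : cmeas F ->
  cmeas (fun x => cint m2 (fun y => F (x, y))).
Proof.
move=> [mr mi]; split => /=; first exact: (measurable_Rintegral_pair mr).
exact: (measurable_Rintegral_pair mi).
Qed.

End fubini.

(** Domination by a product makes every section integrable, not only almost every
one, so that the iterated integrals are pointwise meaningful. *)
Lemma cint_fubini d1 d2 (T1 : measurableType d1) (T2 : measurableType d2)
   (m1 : {sigma_finite_measure set T1 -> \bar R})
   (m2 : {sigma_finite_measure set T2 -> \bar R})
   (F : T1 * T2 -> R[i]) (f : T1 -> R[i]) (g : T2 -> R[i]) :
  cmeas F -> cL1 m1 f -> cL1 m2 g ->
  (forall x y, normc (F (x, y)) <= normc (f x) * normc (g y)) ->
  cint m1 (fun x => cint m2 (fun y => F (x, y))) =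
  cint m2 (fun y => cint m1 (fun x => F (x, y))).
Proof.
move=> mF fL gL Fle.
have [mf fi] := fL; have [mg gi] := gL.
have mnf := cmeas_normc mf; have mng := cmeas_normc mg.
have Ffin : (\int[m1]_x \int[m2]_y (normc (F (x, y)))%:E < +oo)%E.
  apply: (@le_lt_trans _ _ (\int[m1]_x \int[m2]_y (normc (f x) * normc (g y))%:E)%E).
    apply: ge0_le_integral => //=.
    - by move=> x _; apply: integral_ge0 => y _; rewrite lee_fin normc_ge0.
    - apply: (measurable_fun_fubini_tonelli_F (m2 := m2)
        (fun z => (normc (F z))%:E)) => [|z].
        by apply/measurable_EFinP; exact: cmeas_normc.
      by rewrite lee_fin normc_ge0.
    - apply: (measurable_fun_fubini_tonelli_F (m2 := m2)
        (fun z => (normc (f z.1) * normc (g z.2))%:E)) => [|z].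
        apply/measurable_EFinP; apply: measurable_funM.
          by apply: (measurableT_comp mnf); exact: measurable_fst.
        by apply: (measurableT_comp mng); exact: measurable_snd.
      by rewrite lee_fin mulr_ge0 ?normc_ge0.
    - move=> x _; apply: ge0_le_integral => //=.
      + by move=> y _; rewrite lee_fin normc_ge0.
      + apply/measurable_EFinP; apply: (measurableT_comp (cmeas_normc mF)).
        exact: measurable_pair1.
      + by apply/measurable_EFinP; exact: measurable_funM.
      + by move=> y _; rewrite lee_fin.
  under eq_integral => x _.
    under eq_integral do rewrite EFinM.
    rewrite ge0_integralZl//=; last 3 first.
    - exact/measurable_EFinP.
    - by move=> y _; rewrite lee_fin normc_ge0.
    - by rewrite lee_fin normc_ge0.
    over.
  rewrite /= ge0_integralZr//=; last 3 first.
  - exact/measurable_EFinP.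
  - by move=> y _; rewrite lee_fin normc_ge0.
  - by apply: integral_ge0 => y _; rewrite lee_fin normc_ge0.
  rewrite lte_mul_pinfty//.
    by apply: integral_ge0 => y _; rewrite lee_fin normc_ge0.
  rewrite ge0_fin_numE//.
  by apply: integral_ge0 => y _; rewrite lee_fin normc_ge0.
have key (P : T1 * T2 -> R) : measurable_fun setT P ->
    (forall z, `|P z| <= normc (F z)) ->
    \int[m1]_x \int[m2]_y P (x, y) = \int[m2]_y \int[m1]_x P (x, y).
  move=> mP PF.
  have mE : measurable_fun setT (EFin \o P) by exact/measurable_EFinP.
  have iP : (m1 \x m2)%E.-integrable setT (EFin \o P).
    apply/integrable12ltyP => //; apply: le_lt_trans Ffin.
    apply: ge0_le_integral => //=.
    - by move=> x _; apply: integral_ge0.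
    - apply: (measurable_fun_fubini_tonelli_F (m2 := m2)
        (fun z => (`|P z|)%:E)) => [|z]; last by rewrite lee_fin.
      by apply/measurable_EFinP; exact: measurableT_comp.
    - apply: (measurable_fun_fubini_tonelli_F (m2 := m2)
        (fun z => (normc (F z))%:E)) => [|z].
        by apply/measurable_EFinP; exact: cmeas_normc.
      by rewrite lee_fin normc_ge0.
    - move=> x _; apply: ge0_le_integral => //=.
      + apply/measurable_EFinP; apply: measurableT_comp => //.
        by apply: (measurableT_comp mP); exact: measurable_pair1.
      + apply/measurable_EFinP; apply: (measurableT_comp (cmeas_normc mF)).
        exact: measurable_pair1.
      + by move=> y _; rewrite lee_fin.
  have fin1 x : (\int[m2]_y (P (x, y))%:E)%E \is a fin_num.
    apply: (integrable_fin_num (measurableT)).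
    apply/integrableP; split.
      by apply/measurable_EFinP/(measurableT_comp mP); exact: measurable_pair1.
    apply: (@le_lt_trans _ _ (\int[m2]_y ((normc (f x))%:E * (normc (g y))%:E))%E).
      apply: ge0_le_integral => //=.
      - apply/measurable_EFinP; apply: measurableT_comp => //.
        by apply: (measurableT_comp mP); exact: measurable_pair1.
      - by apply/measurable_EFinP; exact: measurable_funM.
      - by move=> y _; rewrite lee_fin (le_trans (PF _)).
    rewrite ge0_integralZl//=; last 3 first.
    - exact/measurable_EFinP.
    - by move=> y _; rewrite lee_fin normc_ge0.
    - by rewrite lee_fin normc_ge0.
    by rewrite lte_mul_pinfty// lee_fin normc_ge0.
  have fin2 y : (\int[m1]_x (P (x, y))%:E)%E \is a fin_num.
    apply: (integrable_fin_num (measurableT)).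
    apply/integrableP; split.
      by apply/measurable_EFinP/(measurableT_comp mP); exact: measurable_pair2.
    apply: (@le_lt_trans _ _ (\int[m1]_x ((normc (g y))%:E * (normc (f x))%:E))%E).
      apply: ge0_le_integral => //=.
      - apply/measurable_EFinP; apply: measurableT_comp => //.
        by apply: (measurableT_comp mP); exact: measurable_pair2.
      - by apply/measurable_EFinP; exact: measurable_funM.
      - by move=> x _; rewrite lee_fin mulrC (le_trans (PF _)).
    rewrite ge0_integralZl//=; last 3 first.
    - exact/measurable_EFinP.
    - by move=> x _; rewrite lee_fin normc_ge0.
    - by rewrite lee_fin normc_ge0.
    by rewrite lte_mul_pinfty// lee_fin normc_ge0.
  rewrite /Rintegral; congr fine.
  under eq_integral => x _ do rewrite fineK//.
  under [RHS]eq_integral => y _ do rewrite fineK//.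
  exact: (Fubini iP).
rewrite /cint /=; congr Complex.
- by apply: (key (fun z => complex.Re (F z))) => [|z];
    [case: mF|exact: Re_le_normc].
- by apply: (key (fun z => complex.Im (F z))) => [|z];
    [case: mF|exact: Im_le_normc].
Qed.

End complex_integral.

(** * Lebesgue measure on R^d *)

Section lebesgue_tuple_theory.
Context {R : realType}.
Local Notation RM := (measurableTypeR R).
Local Notation normc := Normc.normc.

Lemma measurable_discretized d' (S : measurableType d') (p : S -> RM)
    (n : nat) (z : int) : measurable_fun setT p ->
  measurable [set s : S | Num.floor (p s * n.+1%:R) = z].
Proof.
move=> mp; pose f (s : S) : R := p s * n.+1%:R.
have mf : measurable_fun setT f by apply: measurable_funM.
rewrite (_ : [set s | _] = setT `&` f @^-1` `[z%:~R, (z + 1)%:~R[).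
  exact: mf.
rewrite setTI; apply/seteqP; split => s /=; rewrite in_itv /=.
  by move/eqP; rewrite floor_eq.
by rewrite -floor_eq => /eqP.
Qed.

(** The Borel sets of R^d are those of the product of the Borel sets of R, in
the form needed here: a continuous function is a limit of functions of the
coordinates rounded down to multiples of 1 / (n + 1), and these take countably
many values on measurable cells. *)
Lemma continuous_measurable_tuple d (F : 'rV[R]_d -> R) : continuous F ->
  measurable_fun setT (fun t : d.-tuple RM => F (row_of_tuple t)).
Proof.
move=> cF.
pose code n (t : d.-tuple RM) : d.-tuple int :=
  [tuple Num.floor (tnth t i * n.+1%:R) | i < d].
pose q n (z : d.-tuple int) : 'rV[R]_d := \row_i ((tnth z i)%:~R / n.+1%:R).
apply: (@measurable_fun_cvg _ _ _ _ (fun n t => F (q n (code n t)))).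
  move=> n _ B mB; rewrite setTI.
  rewrite (_ : _ @^-1` B = \bigcup_(z : d.-tuple int)
     (if `[< B (F (q n z)) >] then code n @^-1` [set z] else set0)); last first.
    apply/seteqP; split => [t /= Bt|t [z _]].
      by exists (code n t) => //; case: asboolP.
    by case: asboolP => // Bz /= ->.
  apply: countable_bigcupT_measurable => // z; case: asboolP => // _.
  rewrite (_ : _ @^-1` _ = \bigcap_(i in [set: 'I_d])
     [set t : d.-tuple RM | Num.floor (tnth t i * n.+1%:R) = tnth z i]).
    apply: fin_bigcap_measurable => // i _.
    exact: (measurable_discretized (p := fun t : d.-tuple RM => tnth t i)
      n (tnth z i) (@measurable_tnth _ _ _ _)).
  apply/seteqP; split => [t /= <- i _ /=|t /= ti]; first by rewrite tnth_mktuple.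
  by apply: eq_from_tnth => i; rewrite tnth_mktuple; exact: ti.
move=> t _; apply: (cvg_comp _ F _ (cF (row_of_tuple t))).
apply/cvg_ballP => e e0; near=> n.
rewrite /ball /= /mx_ball; split => // i j.
rewrite /ball /= !mxE tnth_mktuple.
set x := tnth t j.
have n0 : 0 < n.+1%:R :> R by rewrite ltr0n.
have /andP[h1 h2] := floor_itv (x * n.+1%:R).
have ne : n.+1%:R^-1 < e by near: n; exact: near_infty_natSinv_lt (PosNum e0).
apply: le_lt_trans ne.
rewrite ger0_norm; last by rewrite subr_ge0 ler_pdivrMr.
rewrite -(@ler_pM2r _ n.+1%:R)// mulrBl mulVf ?gt_eqF// divfK ?gt_eqF//.
by rewrite lerBlDl ltW// (lt_le_trans h2)// intrD.
Unshelve. all: by end_near. Qed.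

Lemma integral_cons d (F : d.+1.-tuple RM -> \bar R) :
  measurable_fun setT F -> (forall t, (0 <= F t)%E) ->
  (\int[lebesgue_tuple d.+1]_t F t =
   \int[lebesgue_measure]_x \int[lebesgue_tuple d]_t F [tuple of x :: t])%E.
Proof.
move=> mF F0 /=.
have mc := @measurable_cons_pair R d.
rewrite (eq_measure_integral
  (pushforward (lebesgue_measure \x lebesgue_tuple d)%E (@cons_pair R d)))//.
rewrite ge0_integral_pushforward//= preimage_setT.
rewrite (fubini_tonelli1 (F \o @cons_pair R d))//.
  exact: measurableT_comp.
by move=> z; exact: F0.
Qed.

(** Both sides are integrals against measures that agree on the intervals ]u, v],
and Lebesgue measure is determined by these. *)
Lemma lebesgue_affine (a b : R) (F : RM -> \bar R) : 0 < a ->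
  measurable_fun setT F -> (forall x, (0 <= F x)%E) ->
  (a%:E * \int[lebesgue_measure]_x F (a * x + b)%R =
   \int[lebesgue_measure]_x F x)%E.
Proof.
move=> a0 mF F0.
pose f (x : RM) : RM := a * x + b.
have mf : measurable_fun setT f.
  by apply: measurable_funD => //; apply: measurable_funM.
rewrite [RHS](eq_measure_integral
    (mscale (NngNum (ltW a0)) (pushforward lebesgue_measure f))); last first.
  move=> A mA _.
  apply: lebesgue_measure_unique => //= X [[u v] _ <-].
  have pre : f @^-1` `]u, v] = `](u - b) / a, (v - b) / a]%classic.
    apply/seteqP; split => x /=; rewrite !in_itv /= /f => /andP[h1 h2].
      rewrite ltr_pdivrMr// ler_pdivlMr// (mulrC x) ltrBlDr lerBrDr.
      by rewrite h1 h2.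
    move: h1 h2; rewrite ltr_pdivrMr// ler_pdivlMr// (mulrC x) ltrBlDr lerBrDr.
    by move=> -> ->.
  transitivity (a%:E * lebesgue_measure (f @^-1` `]u, v]))%E; last by [].
  rewrite pre !lebesgue_measure_itv /= !lte_fin ltr_pM2r ?invr_gt0// ltrD2r.
  case: ifP => _; last by rewrite mule0.
  by rewrite -!EFinB -EFinM; congr EFin; field; rewrite gt_eqF.
rewrite ge0_integral_mscale//=; congr (_ * _)%E.
by rewrite ge0_integral_pushforward.
Qed.

Definition affine_tuple d (a : R) (b : d.-tuple RM) (t : d.-tuple RM) :
  d.-tuple RM := [tuple a * tnth t i + tnth b i | i < d].

Lemma measurable_affine_tuple d a (b : d.-tuple RM) :
  measurable_fun setT (affine_tuple a b).
Proof.
apply/measurable_fun_tnthP => i /=.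
rewrite (_ : _ \o _ = (fun t => a * tnth t i + tnth b i)).
  apply: measurable_funD => //; apply: measurable_funM => //.
  exact: measurable_tnth.
by apply/funext => t /=; rewrite tnth_mktuple.
Qed.

Lemma lebesgue_tuple_affine d (a : R) (b : d.-tuple RM)
    (F : d.-tuple RM -> \bar R) : 0 < a ->
  measurable_fun setT F -> (forall t, (0 <= F t)%E) ->
  ((a ^+ d)%:E * \int[lebesgue_tuple d]_t F (affine_tuple a b t) =
   \int[lebesgue_tuple d]_t F t)%E.
Proof.
move=> a0; elim: d b F => [|d IH] b F mF F0.
  rewrite expr0 mul1e; apply: eq_integral => t _; congr F.
  by apply: eq_from_tnth => -[].
rewrite !integral_cons//; last first.
  by apply: measurableT_comp => //; exact: measurable_affine_tuple.
have [b0 [b' ->]] : exists (b0 : RM) (b' : d.-tuple RM), b = [tuple of b0 :: b'].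
  by exists (thead b), [tuple of behead b]; exact: tuple_eta.
have aff (x : RM) (t : d.-tuple RM) : affine_tuple a [tuple of b0 :: b'] [tuple of x :: t] =
    [tuple of (a * x + b0) :: affine_tuple a b' t].
  apply: eq_from_tnth => i; rewrite tnth_mktuple.
  have [->|[j ->]] : i = ord0 \/ exists j, i = lift ord0 j.
    by case: (unliftP ord0 i) => [j|] ->; [right; exists j|left].
    by rewrite !tnth0.
  by rewrite !tnthS tnth_mktuple.
have mFc (x : RM) : measurable_fun setT (fun t : d.-tuple RM => F [tuple of x :: t]).
  apply: (@measurableT_comp _ _ _ _ _ _ F) => //.
  exact: (@measurable_cons _ _ _ _ (fun=> x) _ id).
have mI : measurable_fun setT
    (fun x : RM => (\int[lebesgue_tuple d]_t F [tuple of x :: t])%E).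
  apply: (measurable_fun_fubini_tonelli_F (m2 := lebesgue_tuple d)
    (F \o @cons_pair R d)) => [|z]; last exact: F0.
  exact: measurableT_comp (@measurable_cons_pair R d).
transitivity (a%:E * \int[lebesgue_measure]_x
    \int[lebesgue_tuple d]_t F [tuple of ((a * x + b0)%R : RM) :: t])%E.
  rewrite exprS EFinM -muleA; congr (_ * _)%E.
  rewrite -ge0_integralZl//=; last 3 first.
  - apply: (@eq_measurable_fun _ _ _ _ _ (fun x : RM =>
      \int[lebesgue_tuple d]_t F [tuple of ((a * x + b0)%R : RM) :: affine_tuple a b' t])%E).
      by move=> x _; apply: eq_integral => t _; rewrite aff.
    apply: (measurable_fun_fubini_tonelli_F (m2 := lebesgue_tuple d)
      (fun z => F [tuple of (a * z.1 + b0) :: affine_tuple a b' z.2])) => [|z]; last exact: F0.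
    apply: (@measurableT_comp _ _ _ _ _ _ F) => //.
    apply: measurable_cons.
      by apply: measurable_funD => //; apply: measurable_funM.
    by apply: (measurableT_comp (@measurable_affine_tuple d a b')).
  - by move=> x _; apply: integral_ge0.
  - by rewrite lee_fin exprn_ge0 ?ltW.
  apply: eq_integral => x _; under eq_integral do rewrite aff.
  exact: (IH b' (fun t => F [tuple of (a * x + b0 : RM) :: t]) (mFc _)
    (fun t => F0 _)).
rewrite (@lebesgue_affine a b0
  (fun y => \int[lebesgue_tuple d]_t F [tuple of y :: t])%E)//.
by move=> x; apply: integral_ge0.
Qed.

End lebesgue_tuple_theory.

(** * The one-dimensional Laplace kernel and its Fourier transform *)

Section laplace_kernel.
Context {R : realType}.
Local Notation RM := (measurableTypeR R).
Local Notation mu := (@lebesgue_measure R).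
Implicit Types v x : R.

Let F v x : R := expR (- x) *
  ((1 + v ^+ 2)^-1 * (v * sin (v * x) - cos (v * x)) - 1).

Let dvN v : 1 + v ^+ 2 != 0 :> R.
Proof. by rewrite gt_eqF// ltr_pwDl// sqr_ge0. Qed.

Let is_derive_F v x : is_derive x 1 (F v) (expR (- x) * (1 + cos (v * x))).
Proof.
have dN : is_derive x 1 (fun y : R => expR (- y)) (- expR (- x)).
  have d1 : is_derive (- x) 1 expR (expR (- x)) by exact: is_derive_expR.
  have d2 : is_derive x 1 (-%R : R -> R) (-1).
    by exact: (is_deriveN (is_derive_id x 1)).
  by have := is_derive1_comp d1 d2; rewrite mulrN1.
have dl : is_derive x 1 (fun y : R => v * y) v.
  by have := is_deriveZ v (is_derive_id x 1); rewrite /GRing.scale /= mulr1.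
have ds : is_derive x 1 (fun y => sin (v * y)) (cos (v * x) * v).
  exact: (is_derive1_comp (is_derive_sin _) dl).
have dc : is_derive x 1 (fun y => cos (v * y)) (- sin (v * x) * v).
  exact: (is_derive1_comp (is_derive_cos _) dl).
have := is_deriveM dN (is_deriveB (is_deriveZ (1 + v ^+ 2)^-1
  (is_deriveB (is_deriveZ v ds) dc)) (is_derive_cst (1 : R) x 1)).
rewrite /GRing.scale /=; set A := (X in is_derive _ _ X _ -> _).
have -> : A = F v by apply: funext.
move=> dA; apply: is_derive_eq.
rewrite !fctE /= /GRing.scale /=; field; exact: dvN.
Qed.

Let continuous_F v : continuous (F v).
Proof.
move=> x; apply/differentiable_continuous/derivable1_diffP.
exact: (@ex_derive _ _ _ _ _ _ _ (is_derive_F v x)).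
Qed.

Let cvg_F v : F v x @[x --> +oo] --> (0 : R).
Proof.
have h : expR (- x) * (`|v| + 2) @[x --> +oo] --> (0 : R).
  rewrite -[X in _ --> X](mul0r (`|v| + 2)); apply: cvgM; last exact: cvg_cst.
  exact: cvgr_expR.
apply: norm_cvg0; apply: (@squeeze_cvgr _ _ _ _ (cst 0)) h; last exact: cvg_cst.
near=> x; rewrite /= normr_ge0 /= /F normrM ger0_norm ?expR_ge0//.
rewrite ler_wpM2l ?expR_ge0// (le_trans (ler_normB _ _))// normr1.
have -> : `|v| + 2 = (`|v| + 1) + 1 :> R by ring.
rewrite lerD2r normrM ger0_norm ?invr_ge0 ?addr_ge0 ?sqr_ge0//.
apply: (@le_trans _ _ (1 * (`|v| + 1))); last by rewrite mul1r.
apply: ler_pM => //.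
- by rewrite invr_ge0 addr_ge0 ?sqr_ge0.
- by rewrite invf_le1 ?lerDl ?sqr_ge0// ltr_pwDl// sqr_ge0.
- rewrite (le_trans (ler_normB _ _))// lerD ?cos_max// normrM.
  by rewrite ler_piMr// sin_max.
Unshelve. all: by end_near. Qed.

Let continuous_integrand v :
  continuous (fun x : R => expR (- `|x|) * (1 + cos (v * x))).
Proof.
move=> x; apply: cvgM.
  apply: continuous_comp; last exact: continuous_expR.
  by apply: cvgN; exact: norm_continuous.
apply: cvgD; first exact: cvg_cst.
apply: continuous_comp; last exact: continuous_cos.
exact: mulrl_continuous.
Qed.

(** Adding 1 to the cosine makes the integrand nonnegative, so that the fundamental
theorem of calculus on a half-line applies; v = 0 gives the mass of the kernel,
which is subtracted afterwards. *)
Lemma integral_laplace_1Dcos v :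
  (\int[mu]_x (expR (- `|x|) * (1 + cos (v * x)))%:E =
   (2 * (1 + (1 + v ^+ 2)^-1))%:E)%E.
Proof.
rewrite (@ge0_symfun_integralT _
  (fun x => expR (- `|x|) * (1 + cos (v * x)))); last 3 first.
- by move=> x; rewrite mulr_ge0 ?expR_ge0.
- exact: continuous_integrand.
- by move=> x /=; rewrite normrN mulrN cosN.
rewrite -set_itvcy EFinM; congr (_ * _)%E.
rewrite (@ge0_continuous_FTC2y _ _ (F v) 0 0); first last.
- move=> x; rewrite in_itv /= andbT => x0; rewrite derive1E.
  rewrite (@derive_val _ _ _ _ _ _ _ (is_derive_F v x)).
  by rewrite ger0_norm// ltW.
- by apply: cvg_at_right_filter; exact: continuous_F.
- by move=> x _; exact: (@ex_derive _ _ _ _ _ _ _ (is_derive_F v x)).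
- exact: cvg_F.
- by apply: continuous_subspaceT; exact: continuous_integrand.
- by move=> x x0; rewrite mulr_ge0 ?expR_ge0.
rewrite sub0e /F !mulr0 sin0 cos0 oppr0 expR0 -EFinN; congr EFin.
by ring.
Qed.

Lemma measurable_laplace : measurable_fun setT (fun x : RM => expR (- `|x : R|)).
Proof.
apply: continuous_measurable_fun => x.
apply: continuous_comp; last exact: continuous_expR.
by apply: cvgN; exact: norm_continuous.
Qed.

Lemma integral_laplace : (\int[mu]_x (expR (- `|x|))%:E = 2%:E)%E.
Proof.
have := integral_laplace_1Dcos 0.
rewrite expr0n /= addr0 invr1 EFinM.
under eq_integral => x _ do rewrite mul0r cos0 mulrC EFinM.
rewrite ge0_integralZl//=; last first.
  by apply/measurable_EFinP; exact: measurable_laplace.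
move=> /(congr1 (fun z => ((1 + 1)^-1%:E * z)%E)).
rewrite muleA -EFinM mulVf ?pnatr_eq0// mul1e => ->.
by rewrite -!EFinM; congr EFin; field.
Qed.

Definition laplace_cis (v : R) (x : RM) : R[i] :=
  (expR (- `|x : R|))%:C%C * cis (- (v * x)).

Lemma normc_laplace_cis v x : Normc.normc (laplace_cis v x) = expR (- `|x|).
Proof.
by rewrite /laplace_cis Normc.normcM normc_cis mulr1 normc_real ger0_norm ?expR_ge0.
Qed.

Lemma cmeas_laplace_cis v : cmeas (laplace_cis v).
Proof.
apply: cmeasM; first by apply: cmeas_real; exact: measurable_laplace.
by apply: cmeas_cis; apply: measurableT_comp => //; exact: measurable_funM.
Qed.

Lemma cL1_laplace_cis v : cL1 mu (laplace_cis v).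
Proof.
split; first exact: cmeas_laplace_cis.
under eq_integral do rewrite normc_laplace_cis.
by rewrite integral_laplace ltry.
Qed.

Lemma Rintegral_odd (f : RM -> R) : measurable_fun setT f ->
  (forall x, f (- x) = - f x) -> \int[mu]_x f x = 0.
Proof.
move=> mf odd; rewrite /Rintegral integralE.
suff -> : (\int[mu]_x ((EFin \o f)^\+ x) = \int[mu]_x ((EFin \o f)^\- x))%E.
  set I := integral _ _ _; have [fI|] := boolP (I \is a fin_num).
    by rewrite subee.
  by rewrite fin_numE negb_and !negbK => /orP[] /eqP ->.
have mE : measurable_fun setT (EFin \o f) by exact/measurable_EFinP.
rewrite [LHS](eq_measure_integral
    (pushforward mu (-%R : RM -> RM))); last first.
  by move=> A mA _; rewrite -[LHS]lebesgue_measureN.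
rewrite ge0_integral_pushforward//=; last exact: measurable_funepos.
apply: eq_integral => x _.
by rewrite /= funeposE funenegE /= odd.
Qed.

(** The transform pair behind the inversion formula: the Abel damping factor and
the Poisson kernel. *)
Lemma cint_laplace_cis v : cint mu (laplace_cis v) = (2 / (1 + v ^+ 2))%:C%C.
Proof.
have E x : laplace_cis v x = Complex (expR (- `|x|) * cos (v * x))
    (- (expR (- `|x|) * sin (v * x))).
  rewrite /laplace_cis /cis cosN sinN.
  by apply/eqP; rewrite eq_complex Re_mulc Im_mulc /= !mul0r subr0 addr0 mulrN !eqxx.
have iL := cL1_Re (cL1_laplace_cis v).
congr Complex; last first.
  under eq_Rintegral do rewrite E /=.
  apply: Rintegral_odd => [|x]; last by rewrite normrN mulrN sinN mulrN.
  have [_] := cmeas_laplace_cis v.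
  by apply: eq_measurable_fun => x _; rewrite E.
have iE : mu.-integrable setT (EFin \o (fun x : RM => expR (- `|x : R|))).
  apply/integrableP; split.
    by apply/measurable_EFinP; exact: measurable_laplace.
  rewrite (eq_integral (fun x : RM => (expR (- `|x : R|))%:E)).
    by rewrite integral_laplace ltry.
  by move=> x _; rewrite /= ger0_norm ?expR_ge0.
have := integral_laplace_1Dcos v.
have -> : (\int[mu]_x (expR (- `|x|) * (1 + cos (v * x)))%:E =
   \int[mu]_x (expR (- `|x|))%:E + \int[mu]_x (complex.Re (laplace_cis v x))%:E)%E.
  rewrite -integralD//; apply: eq_integral => x _.
  by rewrite E /= mulrDr mulr1 EFinD.
rewrite integral_laplace /Rintegral => /(congr1 (fun z => (z - 2%:E)%E)).
rewrite addeAC subee// add0e => ->.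
by rewrite -EFinB /=; ring.
Qed.

Lemma integral_invDsqr : (\int[mu]_x ((1 + x ^+ 2)^-1)%:E = pi%:E)%E.
Proof.
rewrite (@ge0_symfun_integralT _ (fun x => (1 + x ^+ 2)^-1)); last 3 first.
- by move=> x; rewrite invr_ge0 addr_ge0 ?sqr_ge0.
- exact: continuous_oneDsqrV.
- by move=> x /=; rewrite sqrrN.
by rewrite -set_itvcy integral0y_oneDsqr -EFinM; congr EFin; field.
Qed.

End laplace_kernel.

(** * Products of functions of one variable *)

Section tensor.
Context {R : realType}.
Local Notation RM := (measurableTypeR R).
Local Notation normc := Normc.normc.
Local Notation mu := (@lebesgue_measure R).

Lemma measurable_behead_tuple d :
  measurable_fun setT (fun t : d.+1.-tuple RM => [tuple of behead t] : d.-tuple RM).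
Proof. exact: measurable_behead. Qed.

Definition tprod d (k : RM -> R) (t : d.-tuple RM) : R :=
  \prod_(i < d) k (tnth t i).

Lemma tprod_cons d (k : RM -> R) (x : RM) (t : d.-tuple RM) :
  tprod k [tuple of x :: t] = k x * tprod k t.
Proof.
by rewrite /tprod big_ord_recl tnth0; under eq_bigr do rewrite tnthS.
Qed.

Lemma tprod_ge0 d (k : RM -> R) (t : d.-tuple RM) :
  (forall x, 0 <= k x) -> 0 <= tprod k t.
Proof. by move=> k0; apply: prodr_ge0. Qed.

Lemma measurable_tprod d (k : RM -> R) : measurable_fun setT k ->
  measurable_fun setT (@tprod d k).
Proof.
move=> mk; apply: measurable_prod => i _.
exact: (measurableT_comp mk (@measurable_tnth _ _ _ i)).
Qed.

Lemma integral_tprod d (k : RM -> R) (I : R) : measurable_fun setT k ->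
  (forall x, 0 <= k x) -> (\int[mu]_x (k x)%:E = I%:E)%E ->
  (\int[lebesgue_tuple d]_t (tprod k t)%:E = (I ^+ d)%:E)%E.
Proof.
move=> mk k0 ik; elim: d => [|d IH].
  rewrite /= integral_dirac//; first by rewrite diracT mul1e /tprod big_ord0.
  by apply/measurable_EFinP; exact: measurable_tprod.
rewrite integral_cons; first last.
- by move=> t; rewrite lee_fin tprod_ge0.
- by apply/measurable_EFinP; exact: measurable_tprod.
under eq_integral => x _.
  under eq_integral do rewrite tprod_cons EFinM.
  rewrite ge0_integralZl//=; last 3 first.
  - by apply/measurable_EFinP; exact: measurable_tprod.
  - by move=> t _; rewrite lee_fin tprod_ge0.
  - by rewrite lee_fin.
  over.
rewrite /= ge0_integralZr//=; last 3 first.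
- exact/measurable_EFinP.
- by move=> x _; rewrite lee_fin.
- by apply: integral_ge0 => t _; rewrite lee_fin tprod_ge0.
by rewrite ik IH -EFinM exprS.
Qed.

Section cons_product.
Variables (d : nat) (f : RM -> R[i]) (g : d.-tuple RM -> R[i]).
Hypotheses (fL : cL1 mu f) (gL : cL1 (lebesgue_tuple d) g).

Let H (t : d.+1.-tuple RM) := f (thead t) * g [tuple of behead t].

Let H_cons x (t : d.-tuple RM) : H [tuple of x :: t] = f x * g t.
Proof. by rewrite /H theadE; congr (_ * g _); exact: val_inj. Qed.

Lemma cL1_cons : cL1 (lebesgue_tuple d.+1) H.
Proof.
have [mf fi] := fL; have [mg gi] := gL.
have mH : cmeas H.
  apply: cmeasM; first exact: (cmeas_comp mf (@measurable_tnth _ _ _ ord0)).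
  exact: (cmeas_comp mg (@measurable_behead_tuple d)).
split => //; rewrite integral_cons; first last.
- by move=> t; rewrite lee_fin normc_ge0.
- by apply/measurable_EFinP; exact: cmeas_normc.
under eq_integral => x _.
  under eq_integral do rewrite H_cons Normc.normcM EFinM.
  rewrite ge0_integralZl//=; last 3 first.
  - by apply/measurable_EFinP; exact: cmeas_normc.
  - by move=> t _; rewrite lee_fin normc_ge0.
  - by rewrite lee_fin normc_ge0.
  over.
rewrite /= ge0_integralZr//=; last 3 first.
- by apply/measurable_EFinP; exact: cmeas_normc.
- by move=> x _; rewrite lee_fin normc_ge0.
- by apply: integral_ge0 => t _; rewrite lee_fin normc_ge0.
rewrite lte_mul_pinfty//.
  by apply: integral_ge0 => x _; rewrite lee_fin normc_ge0.
rewrite ge0_fin_numE//.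
by apply: integral_ge0 => x _; rewrite lee_fin normc_ge0.
Qed.

(** Fubini for the product of a function of the first coordinate and a function of
the others; induction on the dimension needs no more. *)
Lemma cint_cons : cint (lebesgue_tuple d.+1) H = cint mu f * cint (lebesgue_tuple d) g.
Proof.
have [mH _] := cL1_cons.
have key (P : d.+1.-tuple RM -> R) : measurable_fun setT P ->
    (forall t, `|P t| <= normc (H t)) ->
    \int[lebesgue_tuple d.+1]_t P t =
    \int[mu]_x \int[lebesgue_tuple d]_t P [tuple of x :: t].
  move=> mP PH.
  have mE : measurable_fun setT (EFin \o P) by exact/measurable_EFinP.
  have mEc : measurable_fun setT (EFin \o P \o @cons_pair R d).
    exact: measurableT_comp mE (@measurable_cons_pair R d).
  have iP : (mu \x lebesgue_tuple d)%E.-integrable setT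
      (EFin \o P \o @cons_pair R d).
    apply/integrable12ltyP => //.
    have [_] := cL1_cons; apply: le_lt_trans.
    rewrite -(@integral_cons _ _ (fun t => `|(P t)%:E|)%E)//; last first.
      exact: measurableT_comp.
    apply: ge0_le_integral => //=.
    - by apply/measurable_EFinP; exact: measurableT_comp.
    - by apply/measurable_EFinP; exact: cmeas_normc.
    - by move=> t _; rewrite lee_fin.
  have fin x : (\int[lebesgue_tuple d]_t (P [tuple of x :: t])%:E)%E \is a fin_num.
    have [mg gi] := gL.
    apply: (integrable_fin_num measurableT); apply/integrableP; split.
      apply/measurable_EFinP; apply: (measurableT_comp mP).
      exact: (@measurable_cons _ _ _ _ (fun=> x) _ id).
    apply: (@le_lt_trans _ _
       (\int[lebesgue_tuple d]_t ((normc (f x))%:E * (normc (g t))%:E))%E).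
      apply: ge0_le_integral => //=.
      - apply/measurable_EFinP; apply: measurableT_comp => //.
        apply: (measurableT_comp mP).
        exact: (@measurable_cons _ _ _ _ (fun=> x) _ id).
      - by apply/measurable_EFinP; apply: measurable_funM => //; exact: cmeas_normc.
      - by move=> t _; rewrite lee_fin -Normc.normcM -H_cons.
    rewrite ge0_integralZl//=; last 3 first.
    - by apply/measurable_EFinP; exact: cmeas_normc.
    - by move=> t _; rewrite lee_fin normc_ge0.
    - by rewrite lee_fin normc_ge0.
    by rewrite lte_mul_pinfty// lee_fin normc_ge0.
  rewrite /Rintegral; congr fine.
  under [RHS]eq_integral => x _ do rewrite fineK//.
  rewrite (eq_measure_integral (pushforward (mu \x lebesgue_tuple d)%E
    (@cons_pair R d)))//.
    exact: measurable_cons_pair.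
  move=> mc; rewrite [LHS](integral_pushforward mc (D := setT) mE iP measurableT).
  by rewrite preimage_setT -(integral12_prod_meas1 iP).
have -> : cint (lebesgue_tuple d.+1) H =
    cint mu (fun x => cint (lebesgue_tuple d) (fun t => f x * g t)).
  have [mr mi] := mH; rewrite /cint; congr Complex.
    rewrite (key _ mr (fun t => Re_le_normc _)) /=.
    by apply: eq_Rintegral => x _; apply: eq_Rintegral => t _; rewrite H_cons.
  rewrite (key _ mi (fun t => Im_le_normc _)) /=.
  by apply: eq_Rintegral => x _; apply: eq_Rintegral => t _; rewrite H_cons.
rewrite (eq_cint _ (fun x => cintZ (f x) gL)).
rewrite (eq_cint _ (fun x => mulrC (f x) _)).
by rewrite cintZ// mulrC.
Qed.

End cons_product.

Definition laplace_tuple d (v t : d.-tuple RM) : R[i] :=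
  \prod_(i < d) laplace_cis (tnth v i) (tnth t i).

Lemma laplace_tuple_thead d (v : d.+1.-tuple RM) (t : d.+1.-tuple RM) :
  laplace_tuple v t = laplace_cis (thead v) (thead t) *
    laplace_tuple [tuple of behead v] [tuple of behead t].
Proof.
rewrite /laplace_tuple big_ord_recl; congr (_ * _); apply: eq_bigr => i _.
by rewrite {1}(tuple_eta v) {1}(tuple_eta t) !tnthS.
Qed.

(** Characters are multiplicative, so that the product over the coordinates of the
one-dimensional integrands is a damped character of R^d. *)
Lemma laplace_tupleE d (v t : d.-tuple RM) : laplace_tuple v t =
  (tprod (fun x : RM => expR (- `|x : R|)) t)%:C%C *
  cis (- \sum_i tnth v i * tnth t i).
Proof.
elim: d v t => [|d IH] v t.
  by rewrite /laplace_tuple /tprod !big_ord0 oppr0 cis0 mulr1.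
rewrite /laplace_tuple /tprod /laplace_cis big_split /= -rmorph_prod; congr (_ * _).
rewrite -sumrN; elim/big_rec2 : _ => [|i x y _ ->]; first by rewrite cis0.
by rewrite cisD.
Qed.

Lemma cint_laplace_tuple d (v : d.-tuple RM) :
  cL1 (lebesgue_tuple d) (laplace_tuple v) /\
  cint (lebesgue_tuple d) (laplace_tuple v) =
    (tprod (fun x : RM => 2 / (1 + x ^+ 2)) v)%:C%C.
Proof.
elim: d v => [|d IH] v.
  have L1 : laplace_tuple v = fun=> 1.
    by apply/funext => t; rewrite /laplace_tuple big_ord0.
  have c1 : cL1 (lebesgue_tuple 0) (fun=> 1 : R[i]).
    split => //=; rewrite integral_dirac// diracT mul1e ltry//.
  rewrite L1; split => //; rewrite /tprod big_ord0.
  by rewrite /cint /= /Rintegral !integral_dirac// diracT !mul1e.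
have [IL IE] := IH [tuple of behead v].
have -> : laplace_tuple v = fun t => laplace_cis (thead v) (thead t) *
    laplace_tuple [tuple of behead v] [tuple of behead t].
  by apply/funext => t; exact: laplace_tuple_thead.
split; first by apply: cL1_cons => //; exact: cL1_laplace_cis.
rewrite cint_cons//; last exact: cL1_laplace_cis.
by rewrite IE cint_laplace_cis -rmorphM /= [in RHS](tuple_eta v) tprod_cons.
Qed.

End tensor.

(** * The Euclidean norm and the exponential weights *)

Section euclidean.
Context {R : realType} {d : nat}.
Local Notation RM := (measurableTypeR R).
Implicit Types x y : 'rV[R]_d.

Lemma dotpC x y : dotp x y = dotp y x.
Proof. by apply: eq_bigr => i _; rewrite mulrC. Qed.

Lemma dotpDr x y z : dotp x (y + z) = dotp x y + dotp x z.
Proof. by rewrite -big_split; apply: eq_bigr => i _; rewrite mxE mulrDr. Qed.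

Lemma dotpZr (a : R) x y : dotp x (a *: y) = a * dotp x y.
Proof. by rewrite /dotp mulr_sumr; apply: eq_bigr => i _; rewrite mxE mulrCA. Qed.

Lemma dotpNr x y : dotp x (- y) = - dotp x y.
Proof. by rewrite -scaleN1r dotpZr mulN1r. Qed.

Lemma dotp_ge0 x : 0 <= dotp x x.
Proof. by apply: sumr_ge0 => i _; rewrite -expr2 sqr_ge0. Qed.

Lemma cauchy_schwarz x y : dotp x y ^+ 2 <= dotp x x * dotp y y.
Proof.
set a := dotp x x; set b := dotp x y; set c := dotp y y.
have h : 0 <= c * (a * c - b ^+ 2).
  have := dotp_ge0 (c *: x + (- b) *: y).
  rewrite dotpDr !dotpZr (dotpC _ x) (dotpC _ y) !dotpDr !dotpZr.
  rewrite (dotpC y x) -/a -/b -/c; congr (0 <= _); ring.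
have := dotp_ge0 y; rewrite -/c le_eqVlt => /predU1P[c0|c0].
  rewrite -c0 mulr0; suff -> : b = 0 by rewrite expr0n.
  apply: big1 => i _; suff -> : y 0 i = 0 by rewrite mulr0.
  have := c0; rewrite /c /dotp => /esym/psumr_eq0P => /(_ _ i isT) yi.
  by apply/eqP; rewrite -sqrf_eq0 expr2 yi// => j _; rewrite -expr2 sqr_ge0.
by move: h; rewrite pmulr_rge0// subr_ge0.
Qed.

Lemma euclid_ge0 x : 0 <= euclid x. Proof. exact: sqrtr_ge0. Qed.

Lemma euclidN x : euclid (- x) = euclid x.
Proof. by rewrite /euclid dotpNr dotpC dotpNr opprK. Qed.

Lemma euclid_triangle x y : euclid (x + y) <= euclid x + euclid y.
Proof.
rewrite -(@ler_pXn2r _ 2)// ?nnegrE ?addr_ge0 ?euclid_ge0//.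
rewrite sqrrD !sqr_sqrtr ?dotp_ge0// dotpDr (dotpC _ x) (dotpC _ y) !dotpDr.
rewrite (dotpC y x).
have : dotp x y <= euclid x * euclid y.
  rewrite -sqrtrM ?dotp_ge0//; apply: (le_trans (ler_norm _)).
  by rewrite -sqrtr_sqr ler_wsqrtr// cauchy_schwarz.
set p := dotp x y; set q := euclid x * euclid y => pq.
by rewrite -mulr_natl; lra.
Qed.

Lemma coord_le_euclid x i : `|x 0 i| <= euclid x.
Proof.
rewrite -sqrtr_sqr ler_wsqrtr// /dotp (bigD1 i)//= -expr2 lerDl.
by apply: sumr_ge0 => j _; rewrite -expr2 sqr_ge0.
Qed.

Lemma row_of_tuple_affine (a : R) (b t : d.-tuple RM) :
  row_of_tuple (affine_tuple a b t) = a *: row_of_tuple t + row_of_tuple b.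
Proof. by apply/rowP => i; rewrite !mxE tnth_mktuple. Qed.

Definition tuple_of_row x : d.-tuple RM := [tuple x 0 i | i < d].

Lemma tuple_of_rowK x : row_of_tuple (tuple_of_row x) = x.
Proof. by apply/rowP => i; rewrite !mxE tnth_mktuple. Qed.

Lemma measurable_dotp d' (S : measurableType d') (p q : S -> 'rV[R]_d) :
  (forall i, measurable_fun setT (fun s => p s 0 i)) ->
  (forall i, measurable_fun setT (fun s => q s 0 i)) ->
  measurable_fun setT (fun s => dotp (p s) (q s)).
Proof. by move=> mp mq; apply: measurable_sum => i; exact: measurable_funM. Qed.

Lemma measurable_row_of_tuple i :
  measurable_fun setT (fun t : d.-tuple RM => row_of_tuple t 0 i).
Proof.
by under eq_fun do rewrite mxE; exact: measurable_tnth.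
Qed.

End euclidean.

Section weight_theory.
Context {R : realType} {d : nat}.
Local Notation RM := (measurableTypeR R).
Variable (sigma : R -> R).
Hypothesis sigmaW : weight sigma.
Implicit Types (l : R) (x y : 'rV[R]_d).

Definition wexp l x : R := expR (l * sigma (euclid x)).

Lemma wexp_ge0 l x : 0 <= wexp l x. Proof. exact: expR_ge0. Qed.

Lemma wexpN l x : wexp l (- x) = wexp l x.
Proof. by rewrite /wexp euclidN. Qed.

(** Translation by y costs the factor e^{l sigma|y|}: this is where subadditivity
and monotonicity of the weight are used. *)
Lemma wexp_le l x y : 0 <= l -> wexp l x <= wexp l (x + y) * wexp l y.
Proof.
move=> l0; rewrite /wexp -expRD ler_expR -mulrDr ler_wpM2l//.
have -> : euclid x = euclid ((x + y) + (- y)) by rewrite addrK.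
apply: le_trans (weight_nd sigmaW (euclid_ge0 _) (euclid_triangle _ _)) _.
by rewrite (le_trans (weight_subadd sigmaW (euclid_ge0 _) (euclid_ge0 _)))// euclidN.
Qed.

Lemma wexp_nd l1 l2 x : l1 <= l2 -> wexp l1 x <= wexp l2 x.
Proof.
by move=> l12; rewrite ler_expR ler_wpM2r// (weight_ge0 sigmaW)// euclid_ge0.
Qed.

Lemma measurable_weight : measurable_fun setT (fun t : RM => sigma `|t : R|).
Proof.
have mi : measurable (`[0, +oo[ : set R) by exact: measurable_itv.
have m1 := subspace_continuous_measurable_fun mi (weight_cont sigmaW).
move=> _ B mB; rewrite setTI.
rewrite (_ : _ @^-1` B = setT `&` (fun t : RM => `|t : R|) @^-1`
   (`[0, +oo[ `&` sigma @^-1` B)).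
  have mn : measurable_fun setT (fun t : RM => `|t : R|) by exact: measurableT_comp.
  by apply: mn => //; exact: m1.
by rewrite setTI; apply/seteqP; split=> t /=; rewrite in_itv /= normr_ge0 /=;
  [|case].
Qed.

Lemma measurable_sigma_euclid d' (S : measurableType d') (p : S -> 'rV[R]_d) :
  (forall i, measurable_fun setT (fun s => p s 0 i)) ->
  measurable_fun setT (fun s => sigma (euclid (p s))).
Proof.
move=> mp; apply: (@eq_measurable_fun _ _ _ _ _
    (fun s => sigma `|euclid (p s)|)).
  by move=> s _; rewrite ger0_norm// euclid_ge0.
apply: (measurableT_comp measurable_weight).
apply: (@measurableT_comp _ _ _ _ _ _ (@Num.sqrt R)).
  by apply: continuous_measurable_fun; exact: sqrt_continuous.
exact: measurable_dotp.
Qed.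

Lemma measurable_wexp l d' (S : measurableType d') (p : S -> 'rV[R]_d) :
  (forall i, measurable_fun setT (fun s => p s 0 i)) ->
  measurable_fun setT (fun s => wexp l (p s)).
Proof.
move=> mp; apply: measurableT_comp; first exact: measurable_expR.
by apply: measurable_funM => //; exact: measurable_sigma_euclid.
Qed.

End weight_theory.

(** * Superpositions of characters and their Fourier transforms *)

Local Arguments fourier : simpl never.
Local Arguments cint : simpl never.
Local Arguments Normc.normc : simpl never.

Section fourier_theory.
Context {R : realType} {d : nat}.
Local Notation RM := (measurableTypeR R).
Local Notation normc := Normc.normc.
Local Notation lam := (@lebesgue_tuple R d).
Local Notation row := (@row_of_tuple R d).
Implicit Types f : 'rV[R]_d -> R[i].

Definition cL1row f := cL1 lam (f \o row).

Lemma fourierE f xi :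
  fourier f xi = cint lam (fun t => f (row t) * cis (- dotp (row t) xi)).
Proof. by []. Qed.

Lemma cmeas_cis_dotp d' (S : measurableType d') (p q : S -> 'rV[R]_d) :
  (forall i, measurable_fun setT (fun s => p s 0 i)) ->
  (forall i, measurable_fun setT (fun s => q s 0 i)) ->
  cmeas (fun s => cis (- dotp (p s) (q s))).
Proof.
by move=> mp mq; apply: cmeas_cis; apply: measurableT_comp => //;
  exact: measurable_dotp.
Qed.

Lemma cL1_modulated f xi : cL1row f ->
  cL1 lam (fun t => f (row t) * cis (- dotp (row t) xi)).
Proof.
move=> [mf fi]; split.
  apply: cmeasM => //; apply: cmeas_cis_dotp => i //.
  exact: measurable_row_of_tuple.
by under eq_integral do rewrite Normc.normcM normc_cis mulr1.
Qed.

Lemma normc_fourier f xi : cL1row f ->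
  ((normc (fourier f xi))%:E <= 2%:E * \int[lam]_t (normc (f (row t)))%:E)%E.
Proof.
move=> fL; apply: le_trans (normc_cint (cL1_modulated xi fL)) _.
by under eq_integral do rewrite Normc.normcM normc_cis mulr1.
Qed.

Lemma fourier_bounded f : cL1row f -> exists M, forall xi, normc (fourier f xi) <= M.
Proof.
move=> fL; have [_ fi] := fL.
exists (2 * fine (\int[lam]_t (normc (f (row t)))%:E)%E) => xi.
rewrite -lee_fin EFinM fineK; first exact: normc_fourier.
by rewrite ge0_fin_numE//; apply: integral_ge0 => t _; rewrite lee_fin normc_ge0.
Qed.

Lemma cmeas_fourier d' (S : measurableType d') f (p : S -> 'rV[R]_d) :
  cL1row f -> (forall i, measurable_fun setT (fun s => p s 0 i)) ->
  cmeas (fun s => fourier f (p s)).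
Proof.
move=> [mf _] mp.
apply: (cmeas_cint_pair lam
  (F := fun z => f (row z.2) * cis (- dotp (row z.2) (p z.1)))).
apply: cmeasM; first by apply: (cmeas_comp mf); exact: measurable_snd.
apply: cmeas_cis_dotp => i.
  by apply: (measurableT_comp (measurable_row_of_tuple i)); exact: measurable_snd.
by apply: (measurableT_comp (mp i)); exact: measurable_fst.
Qed.

Lemma integral_translate (G : 'rV[R]_d -> \bar R) (y : 'rV[R]_d) :
  measurable_fun setT (G \o row) -> (forall x, (0 <= G x)%E) ->
  (\int[lam]_t G (row t + y)%R = \int[lam]_t G (row t))%E.
Proof.
move=> mG G0.
rewrite -[RHS](@lebesgue_tuple_affine R d 1 (tuple_of_row y) (G \o row))//.
  rewrite expr1n mul1e; apply: eq_integral => t _.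
  by rewrite /= row_of_tuple_affine scale1r tuple_of_rowK.
by move=> t; exact: G0.
Qed.

Section superposition.
Context d' (S : measurableType d') (nu : {sigma_finite_measure set S -> \bar R}).
Variables (b : S -> R[i]) (p : S -> 'rV[R]_d).
Hypothesis bL : cL1 nu b.
Hypothesis mp : forall i, measurable_fun setT (fun s => p s 0 i).

(** One integral for two kinds of superpositions of characters: nu is the counting
measure in the gliding hump, and Lebesgue measure when a function is recovered
from its Fourier transform. *)
Definition superpose (x : 'rV[R]_d) : R[i] :=
  cint nu (fun s => b s * cis (- dotp x (p s))).

Lemma cL1_superpose x : cL1 nu (fun s => b s * cis (- dotp x (p s))).
Proof.
have [mb bi] := bL; split.
  by apply: cmeasM => //; apply: cmeas_cis_dotp => i.
by under eq_integral do rewrite Normc.normcM normc_cis mulr1.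
Qed.

Lemma cmeas_superpose : cmeas (superpose \o row).
Proof.
have [mb _] := bL.
apply: (cmeas_cint_pair nu
  (F := fun z => b z.2 * cis (- dotp (row z.1) (p z.2)))).
apply: cmeasM; first by apply: (cmeas_comp mb); exact: measurable_snd.
apply: cmeas_cis_dotp => i.
  by apply: (measurableT_comp (measurable_row_of_tuple i)); exact: measurable_fst.
by apply: (measurableT_comp (mp i)); exact: measurable_snd.
Qed.

Lemma superpose_bounded : exists M, forall x, normc (superpose x) <= M.
Proof.
have [_ bi] := bL.
exists (2 * fine (\int[nu]_s (normc (b s))%:E)%E) => x.
rewrite -lee_fin EFinM fineK; last first.
  by rewrite ge0_fin_numE//; apply: integral_ge0 => s _; rewrite lee_fin normc_ge0.
apply: le_trans (normc_cint (cL1_superpose x)) _.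
by under eq_integral do rewrite Normc.normcM normc_cis mulr1.
Qed.

(** Multiplying by a character translates the Fourier transform; Fubini extends this
to superpositions. *)
Lemma fourier_superpose f xi : cL1row f ->
  fourier (fun x => f x * superpose x) xi =
  cint nu (fun s => b s * fourier f (xi + p s)).
Proof.
move=> fL; have [mf fi] := fL; have [mb bi] := bL.
pose F (z : d.-tuple RM * S) := f (row z.1) * cis (- dotp (row z.1) xi) *
  (b z.2 * cis (- dotp (row z.1) (p z.2))).
transitivity (cint lam (fun t => cint nu (fun s => F (t, s)))).
  apply: eq_cint => t; rewrite mulrAC -cintZ//; exact: cL1_superpose.
rewrite (cint_fubini (f := f \o row) (g := b))//; last 2 first.
- apply: cmeasM; apply: cmeasM.
  + by apply: (cmeas_comp mf); exact: measurable_fst.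
  + apply: cmeas_cis_dotp => i //.
    by apply: (measurableT_comp (measurable_row_of_tuple i)); exact: measurable_fst.
  + by apply: (cmeas_comp mb); exact: measurable_snd.
  + apply: cmeas_cis_dotp => i.
      by apply: (measurableT_comp (measurable_row_of_tuple i)); exact: measurable_fst.
    by apply: (measurableT_comp (mp i)); exact: measurable_snd.
- by move=> t s; rewrite /F /= !Normc.normcM !normc_cis !mulr1.
apply: eq_cint => s; rewrite fourierE -cintZ; last exact: cL1_modulated.
apply: eq_cint => t.
by rewrite /F /= dotpDr opprD cisD [LHS]mulrACA [RHS]mulrCA !mulrA.
Qed.

Lemma cL1row_superpose f : cL1row f -> cL1row (fun x => f x * superpose x).
Proof.
move=> [mf fi]; have [M BM] := superpose_bounded.
apply: (@cL1_le _ _ _ lam _ (fun t => normc (f (row t)) * M)).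
- by apply: cmeasM => //; exact: cmeas_superpose.
- by apply: measurable_funM => //; exact: (cmeas_normc mf).
- by move=> t; rewrite /= Normc.normcM ler_wpM2l ?normc_ge0.
have M0 : 0 <= M by apply: le_trans (BM 0); exact: normc_ge0.
under eq_integral do rewrite EFinM.
rewrite ge0_integralZr//=; last 2 first.
- by apply/measurable_EFinP; exact: (cmeas_normc mf).
- by move=> t _; rewrite lee_fin normc_ge0.
by rewrite muleC lte_mul_pinfty.
Qed.

(** By Tonelli, since each character acts by a translation of the Fourier transform,
of norm at most e^{l sigma|p(s)|} on the weighted space. *)
Lemma fnorm_superpose sigma l f : weight sigma -> 0 <= l -> cL1row f ->
  (fnorm sigma l f < +oo)%E ->
  (fnorm sigma l (fun x => (f x * superpose x)%R) <=
   2%:E * (\int[nu]_s (normc (b s) * wexp sigma l (p s))%:E * fnorm sigma l f))%E.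
Proof.
move=> sW l0 fL fN; have [mb bi] := bL.
have wM (x : 'rV[R]_d) : (0 <= wexp sigma l x) by exact: wexp_ge0.
have mw := measurable_wexp sW l.
have mrow := @measurable_row_of_tuple R d.
have mrow1 i : measurable_fun setT (fun z : d.-tuple RM * S => row z.1 0 i).
  by apply: (measurableT_comp (mrow i)); exact: measurable_fst.
have mp2 i : measurable_fun setT (fun z : d.-tuple RM * S => p z.2 0 i).
  by apply: (measurableT_comp (mp i)); exact: measurable_snd.
have mrp i : measurable_fun setT (fun z : d.-tuple RM * S => (row z.1 + p z.2) 0 i).
  by under eq_fun do rewrite mxE; exact: measurable_funD.
pose G (z : d.-tuple RM * S) : R :=
  normc (b z.2) * normc (fourier f (row z.1 + p z.2)) * wexp sigma l (row z.1).
have G0 z : 0 <= G z by rewrite !mulr_ge0 ?normc_ge0.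
have mb2 : measurable_fun setT (fun z : d.-tuple RM * S => normc (b z.2)).
  by apply: (measurableT_comp (cmeas_normc mb)); exact: measurable_snd.
have mG : measurable_fun setT G.
  apply: measurable_funM; last exact: mw.
  apply: measurable_funM => //.
  by apply: cmeas_normc; exact: cmeas_fourier.
have mGE : measurable_fun setT (EFin \o G) by exact/measurable_EFinP.
have GE0 z : (0 <= (EFin \o G) z)%E by rewrite lee_fin.
have [M FM] := fourier_bounded fL.
have step1 t : ((normc (fourier (fun x => f x * superpose x) (row t)) *
    wexp sigma l (row t))%:E <= 2%:E * \int[nu]_s (G (t, s))%:E)%E.
  rewrite fourier_superpose//.
  have mfs : cmeas (fun s => fourier f (row t + p s)).
    apply: cmeas_fourier => // i; under eq_fun do rewrite mxE.
    by apply: measurable_funD => //; exact: mp.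
  have cL : cL1 nu (fun s => b s * fourier f (row t + p s)).
    apply: (@cL1_le _ _ _ nu _ (fun s => normc (b s) * M)).
    - exact: cmeasM.
    - by apply: measurable_funM => //; exact: (cmeas_normc mb).
    - by move=> s; rewrite Normc.normcM ler_wpM2l ?normc_ge0.
    have M0 : 0 <= M by apply: le_trans (FM 0); exact: normc_ge0.
    under eq_integral do rewrite EFinM.
    rewrite ge0_integralZr//=; last 2 first.
    + by apply/measurable_EFinP; exact: (cmeas_normc mb).
    + by move=> s _; rewrite lee_fin normc_ge0.
    by rewrite muleC lte_mul_pinfty.
  have := normc_cint cL => /(@lee_wpmul2r _ (wexp sigma l (row t))%:E).
  rewrite lee_fin => /(_ (wM _)); rewrite EFinM => /le_trans; apply.
  rewrite -muleA lee_wpmul2l// -ge0_integralZr//=; last 3 first.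
  - by apply/measurable_EFinP/cmeas_normc; exact: cmeasM.
  - by move=> s _; rewrite lee_fin normc_ge0.
  - by rewrite lee_fin.
  rewrite le_eqVlt; apply/orP; left; apply/eqP; apply: eq_integral => s _.
  by rewrite /G /= Normc.normcM EFinM.
apply: (@le_trans _ _ (\int[lam]_t (2%:E * \int[nu]_s (G (t, s))%:E))%E).
  apply: ge0_le_integral => //=.
  - by move=> t _; rewrite lee_fin mulr_ge0 ?normc_ge0.
  - apply/measurable_EFinP; apply: measurable_funM; last exact: mw.
    apply: cmeas_normc; apply: cmeas_fourier => //.
    exact: cL1row_superpose.
  - apply: measurable_funeM.
    exact: (measurable_fun_fubini_tonelli_F (m2 := nu) (EFin \o G)).
rewrite ge0_integralZl//=; last 2 first.
- exact: (measurable_fun_fubini_tonelli_F (m2 := nu) (EFin \o G)).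
- by move=> t _; apply: integral_ge0 => s _; rewrite lee_fin.
rewrite lee_wpmul2l//.
rewrite (fubini_tonelli (m1 := lam) (m2 := nu) (EFin \o G))//.
have fN0 : (0 <= fnorm sigma l f)%E.
  by apply: integral_ge0 => t _; rewrite lee_fin mulr_ge0 ?normc_ge0.
rewrite -ge0_integralZr//=; last 2 first.
- apply/measurable_EFinP; apply: measurable_funM; last exact: mw.
  exact: (cmeas_normc mb).
- by move=> s _; rewrite lee_fin mulr_ge0 ?normc_ge0.
apply: ge0_le_integral => //=.
- by move=> s _; apply: integral_ge0 => t _; rewrite lee_fin.
- exact: (measurable_fun_fubini_tonelli_G (m1 := lam) (EFin \o G)).
- apply: emeasurable_funM => //; apply/measurable_EFinP.
  by apply: measurable_funM; [exact: (cmeas_normc mb)|exact: mw].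
move=> s _.
have mFs i : measurable_fun setT (fun t : d.-tuple RM => (row t + p s) 0 i).
  by under eq_fun do rewrite mxE; apply: measurable_funD.
apply: (@le_trans _ _ (\int[lam]_t ((normc (b s) * wexp sigma l (p s))%:E *
    (normc (fourier f (row t + p s)%R) * wexp sigma l (row t + p s)%R)%:E))%E).
  apply: ge0_le_integral => //=.
  - by move=> t _; rewrite lee_fin.
  - by apply/measurable_EFinP; apply: (measurableT_comp mG); exact: measurable_pair2.
  - apply/measurable_EFinP; apply: measurable_funM => //; apply: measurable_funM.
      by apply: cmeas_normc; exact: cmeas_fourier.
    exact: mw.
  - move=> t _; rewrite lee_fin /G /= -!mulrA ler_wpM2l ?normc_ge0//.
    rewrite mulrCA ler_wpM2l ?normc_ge0// mulrC.
    exact: wexp_le.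
have mS : measurable_fun setT (fun t : d.-tuple RM =>
    (normc (fourier f (row t + p s)) * wexp sigma l (row t + p s))%:E).
  apply/measurable_EFinP; apply: measurable_funM; last exact: mw.
  by apply: cmeas_normc; exact: cmeas_fourier.
rewrite (ge0_integralZl lam measurableT mS); last 2 first.
- by move=> t _; rewrite lee_fin mulr_ge0 ?normc_ge0.
- by rewrite lee_fin mulr_ge0 ?normc_ge0.
rewrite (@integral_translate (fun x => (normc (fourier f x) * wexp sigma l x)%:E)
   (p s))//.
- apply/measurable_EFinP; apply: measurable_funM; last exact: mw.
  by apply: cmeas_normc; exact: cmeas_fourier.
- by move=> x; rewrite lee_fin mulr_ge0 ?normc_ge0.
Qed.

End superposition.

End fourier_theory.

(** * Dominated convergence, affine changes of variables, compact support *)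

Section complex_convergence.
Context {R : realType}.
Local Notation normc := Normc.normc.

Lemma normcB_sym (z w : R[i]) : normc (z - w) = normc (w - z).
Proof. by rewrite -opprB normcN. Qed.

Lemma cmeasB d (T : measurableType d) (f g : T -> R[i]) :
  cmeas f -> cmeas g -> cmeas (fun x => f x - g x).
Proof.
move=> [fr fi] [gr gi]; split.
  by under eq_fun do rewrite Re_subc; exact: measurable_funB.
by under eq_fun do rewrite Im_subc; exact: measurable_funB.
Qed.

Lemma cintB d (T : measurableType d) (mu : {measure set T -> \bar R})
    (f g : T -> R[i]) : cL1 mu f -> cL1 mu g ->
  cint mu (fun x => f x - g x) = cint mu f - cint mu g.
Proof.
move=> fL gL.
rewrite /cint; apply/eqP; rewrite eq_complex Re_subc Im_subc /=.
under eq_Rintegral do rewrite Re_subc.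
under [X in _ && (X == _)]eq_Rintegral do rewrite Im_subc.
by rewrite !RintegralB ?eqxx//; [exact: cL1_Im|exact: cL1_Im|exact: cL1_Re|exact: cL1_Re].
Qed.

(** Dominated convergence, for the moduli of the differences. *)
Lemma cint_cvg d (T : measurableType d) (mu : {measure set T -> \bar R})
    (g_ : nat -> T -> R[i]) (g : T -> R[i]) (G : T -> R) :
  (forall n, cmeas (g_ n)) -> cmeas g -> measurable_fun setT G ->
  (\int[mu]_x (G x)%:E < +oo)%E ->
  (forall n x, normc (g_ n x) <= G x) -> (forall x, normc (g x) <= G x) ->
  (forall x, normc (g_ n x - g x) @[n --> \oo] --> (0 : R)) ->
  normc (cint mu (g_ n) - cint mu g) @[n --> \oo] --> (0 : R).
Proof.
move=> mg_ mg mG iG g_G gG gg.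
have G0 x : 0 <= G x by apply: le_trans (gG x); exact: normc_ge0.
have gL : cL1 mu g by exact: cL1_le gG iG.
have g_L n : cL1 mu (g_ n) by exact: cL1_le (g_G n) iG.
have i2G : (\int[mu]_x (2 * G x)%:E < +oo)%E.
  under eq_integral do rewrite EFinM.
  rewrite ge0_integralZl//=; first by rewrite lte_mul_pinfty.
    exact/measurable_EFinP.
  by move=> x _; rewrite lee_fin.
have dL n : cL1 mu (fun x => g_ n x - g x).
  apply: (@cL1_le _ _ _ mu _ (fun x => 2 * G x)).
  - exact: cmeasB.
  - exact: measurable_funM.
  - move=> x; apply: le_trans (le_normcD _ _) _; rewrite normcN.
    by rewrite -[2]/(1 + 1)%:R mulr_natl mulr2n lerD.
  - exact: i2G.
have mE : measurable_fun setT (EFin \o G) by exact/measurable_EFinP.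
have cvgI : (\int[mu]_x (normc (g_ n x - g x))%:E)%E @[n --> \oo] --> 0%E.
  rewrite [X in _ --> X](_ : 0%E = \int[mu]_x 0%E)%E; last by rewrite integral0.
  apply: (@dominated_cvg _ _ _ mu setT measurableT
    (fun n x => (normc (g_ n x - g x))%:E) (cst 0%E) (fun x => (2 * G x)%:E)).
  - move=> n; apply/measurable_EFinP; apply: cmeas_normc; exact: cmeasB.
  - move=> x _; apply: cvg_EFin; first by near=> n.
    exact: gg.
  - by [].
  - apply/integrableP; split.
      by apply/measurable_EFinP; exact: measurable_funM.
    by under eq_integral do rewrite /= ger0_norm ?mulr_ge0//.
  - move=> n x _; rewrite /= ger0_norm ?normc_ge0// lee_fin.
    apply: le_trans (le_normcD _ _) _; rewrite normcN.
    by rewrite -[2]/(1 + 1)%:R mulr_natl mulr2n lerD.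
have cvgI2 : fine (\int[mu]_x (normc (g_ n x - g x))%:E)%E @[n --> \oo] --> (0 : R).
  exact: (@fine_cvg _ _ _ _ _ _ cvgI).
apply: (@squeeze_cvgr _ _ _ _ (cst 0)
  (fun n => 2 * fine (\int[mu]_x (normc (g_ n x - g x))%:E)%E)).
- near=> n; rewrite normc_ge0 /= -lee_fin EFinM fineK.
    by rewrite -cintB//; exact: normc_cint.
  have [_ dn] := dL n.
  by rewrite ge0_fin_numE//; apply: integral_ge0 => x _; rewrite lee_fin normc_ge0.
- exact: cvg_cst.
- by rewrite -[X in _ --> X](mulr0 2); apply: cvgM => //; exact: cvg_cst.
Unshelve. all: by end_near. Qed.

Lemma normc_cvg_unique (A : nat -> R[i]) (z w : R[i]) :
  normc (A n - z) @[n --> \oo] --> (0 : R) ->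
  normc (A n - w) @[n --> \oo] --> (0 : R) -> z = w.
Proof.
move=> Az Aw; apply/eqP; rewrite -subr_eq0; apply/eqP/Normc.eq0_normc.
apply/eqP; rewrite eq_le normc_ge0 andbT.
have h : normc (A n - z) + normc (A n - w) @[n --> \oo] --> (0 : R).
  by rewrite -[X in _ --> X](addr0 0); exact: cvgD.
apply: (ler_cvg_to (cvg_cst (normc (z - w))) h); near=> n.
rewrite normcB_sym -(subrKA (A n)) (le_trans (le_normcD _ _))//.
by rewrite addrC lerD2l normcB_sym.
Unshelve. all: by end_near. Qed.

Lemma cint_affine d (a : R) b (g : d.-tuple (measurableTypeR R) -> R[i]) :
  0 < a -> cL1 (lebesgue_tuple d) g ->
  cL1 (lebesgue_tuple d) (g \o affine_tuple a b) /\
  (a ^+ d)%:C%C * cint (lebesgue_tuple d) (g \o affine_tuple a b) =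
    cint (lebesgue_tuple d) g.
Proof.
move=> a0 gL; have [mg gi] := gL.
have ad : 0 < a ^+ d by rewrite exprn_gt0.
have scale := @lebesgue_tuple_affine R d a b _ a0.
have L : cL1 (lebesgue_tuple d) (g \o affine_tuple a b).
  split; first exact: (cmeas_comp mg (@measurable_affine_tuple _ _ _ _)).
  have := gi; rewrite -scale; first last.
  - by move=> t; rewrite lee_fin normc_ge0.
  - by apply/measurable_EFinP; exact: cmeas_normc.
  set I := integral _ _ _ => h.
  have : (0 <= I)%E by apply: integral_ge0 => t _; rewrite lee_fin normc_ge0.
  case: I h => [r _ _|h _|_ //]; first by rewrite ltry.
  by move: h; rewrite gt0_muley ?lte_fin.
split => //.
have key (P : d.-tuple (measurableTypeR R) -> R) :
    (lebesgue_tuple d).-integrable setT (EFin \o P) ->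
    (lebesgue_tuple d).-integrable setT (EFin \o (P \o affine_tuple a b)) ->
    a ^+ d * \int[lebesgue_tuple d]_t P (affine_tuple a b t) =
    \int[lebesgue_tuple d]_t P t.
  move=> iP iPa; have mP : measurable_fun setT (EFin \o P).
    by case/integrableP : iP => ? _.
  rewrite /Rintegral [in RHS]integralE.
  rewrite -(scale _ (measurable_funepos mP) (fun t => funepos_ge0 _ t)).
  rewrite -(scale _ (measurable_funeneg mP) (fun t => funeneg_ge0 _ t)).
  have -> : (\int[lebesgue_tuple d]_t (P (affine_tuple a b t))%:E =
    \int[lebesgue_tuple d]_t ((EFin \o P)^\+ (affine_tuple a b t)) -
    \int[lebesgue_tuple d]_t ((EFin \o P)^\- (affine_tuple a b t)))%E.
    by rewrite integralE; congr (_ - _)%E; apply: eq_integral => t _;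
      rewrite ?funeposE ?funenegE.
  have fp : (\int[lebesgue_tuple d]_t ((EFin \o P)^\+ (affine_tuple a b t)))%E
     \is a fin_num.
    have := integrable_pos_fin_num measurableT iPa; congr (_ \is a fin_num).
    by apply: eq_integral => t _; rewrite !funeposE.
  have fn : (\int[lebesgue_tuple d]_t ((EFin \o P)^\- (affine_tuple a b t)))%E
     \is a fin_num.
    have := integrable_neg_fin_num measurableT iPa; congr (_ \is a fin_num).
    by apply: eq_integral => t _; rewrite !funenegE.
  move: fp fn; case: (integral _ _ _) => // u _; case: (integral _ _ _) => // v _.
  by rewrite -!EFinM -!EFinB /= mulrBr.
apply/eqP; rewrite eq_complex Re_mulc Im_mulc /= !mul0r subr0 addr0.
rewrite /cint /=.
have -> := key (fun t => complex.Re (g t)) (cL1_Re gL) (cL1_Re L).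
have -> := key (fun t => complex.Im (g t)) (cL1_Im gL) (cL1_Im L).
by rewrite !eqxx.
Qed.

End complex_convergence.

Section compact_support.
Context {R : realType} {d : nat}.
Local Notation RM := (measurableTypeR R).
Local Notation normc := Normc.normc.
Implicit Types (f : 'rV[R]_d -> R[i]) (Omega K : set 'rV[R]_d).

Lemma csupport_out f x : ~ csupport f x -> f x = 0.
Proof.
by move=> nfx; apply: contrapT => /eqP fx; apply: nfx; exact: subset_closure.
Qed.

Lemma continuous_compact_bounded (G : 'rV[R]_d -> R) K : continuous G ->
  compact K -> (forall x, ~ K x -> G x = 0) -> exists M, forall x, `|G x| <= M.
Proof.
move=> cG cK GK.
have cGK : compact (G @` K).
  by apply: continuous_compact => //; exact: continuous_subspaceT.
have [M [Mr hM]] := compact_bounded cGK.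
exists (Num.max 0 (M + 1)) => x; have [Kx|nKx] := pselect (K x).
  have h : `|G x| <= M + 1.
    by apply: (hM (M + 1)) => /=; [rewrite ltrDl|exists x].
  by rewrite le_max h orbT.
by rewrite GK// normr0 le_max lexx.
Qed.

Lemma continuous_prod_1Dsqr :
  continuous (fun x : 'rV[R]_d => \prod_(i < d) (1 + x 0 i ^+ 2)).
Proof.
elim: (index_enum _) => [|j s IH].
  rewrite (_ : (fun x => _) = fun=> 1); first exact: cst_continuous.
  by apply/funext => x; rewrite big_nil.
rewrite (_ : (fun x => _) = (fun x : 'rV[R]_d => (1 + x 0 j * x 0 j) *
    \prod_(i <- s) (1 + x 0 i ^+ 2))); last first.
  by apply/funext => x; rewrite big_cons expr2.
move=> x.
pose c (y : 'rV[R]_d) : R := y 0 j.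
have cc : {for x, continuous c} by exact: coord_continuous.
have c1 : {for x, continuous ((fun=> 1 : R) : 'rV[R]_d -> R)}.
  exact: cst_continuous.
exact: (continuousM (continuousD c1 (continuousM cc cc)) (IH x)).
Qed.

(** The product of the 1 / (1 + x_i^2) is an integrable majorant whose integral is
already known, and G divided by it is still continuous with compact support. *)
Lemma continuous_compact_tprod (G : 'rV[R]_d -> R) K : continuous G ->
  compact K -> (forall x, ~ K x -> G x = 0) ->
  exists M, forall t : d.-tuple RM,
    `|G (row_of_tuple t)| <= M * tprod (fun x : RM => (1 + x ^+ 2)^-1) t.
Proof.
move=> cG cK GK.
have [|x nKx|M hM] := @continuous_compact_bounded
    (fun x => G x * \prod_(i < d) (1 + x 0 i ^+ 2)) K _ cK.
- by move=> x; exact: (continuousM (cG x) (@continuous_prod_1Dsqr x)).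
- by rewrite GK// mul0r.
exists M => t; have := hM (row_of_tuple t).
have P0 : 0 < \prod_(i < d) (1 + row_of_tuple t 0 i ^+ 2).
  by apply: prodr_gt0 => i _; rewrite ltr_pwDl// sqr_ge0.
rewrite normrM (gtr0_norm P0) -ler_pdivlMr// /tprod prodfV => /le_trans; apply.
by rewrite le_eqVlt; apply/orP; left; apply/eqP; congr (_ / _);
  apply: eq_bigr => i _; rewrite mxE.
Qed.

Lemma measurable_invDsqr : measurable_fun setT (fun x : RM => (1 + (x : R) ^+ 2)^-1).
Proof. by apply: continuous_measurable_fun; exact: continuous_oneDsqrV. Qed.

Lemma invDsqr_ge0 (x : RM) : 0 <= (1 + (x : R) ^+ 2)^-1.
Proof. by rewrite invr_ge0 addr_ge0 ?sqr_ge0. Qed.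

Lemma Cc_cL1row Omega f : Cc Omega f -> cL1row f.
Proof.
move=> [[cr ci] cK _].
have [Mr hr] := continuous_compact_tprod cr cK
  (fun x nx => congr1 (@complex.Re R) (csupport_out nx)).
have [Mi hi] := continuous_compact_tprod ci cK
  (fun x nx => congr1 (@complex.Im R) (csupport_out nx)).
apply: (@cL1_le _ _ _ _ _ (fun t => (Mr + Mi) *
   tprod (fun x : RM => (1 + x ^+ 2)^-1) t)).
- by split; [exact: (continuous_measurable_tuple cr)|
    exact: (continuous_measurable_tuple ci)].
- apply: measurable_funM => //; apply: measurable_tprod.
  exact: measurable_invDsqr.
- move=> t; rewrite mulrDl (le_trans (normc_le_add _))//.
  exact: lerD (hr t) (hi t).
have it := @integral_tprod R d _ _ measurable_invDsqr invDsqr_ge0 integral_invDsqr.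
have M0 : 0 <= Mr + Mi.
  have p0 : 0 < tprod (fun x : RM => (1 + (x : R) ^+ 2)^-1) (tuple_of_row (0 : 'rV[R]_d)).
    by apply: prodr_gt0 => i _; rewrite invr_gt0 ltr_pwDl// sqr_ge0.
  rewrite -(pmulr_lge0 _ p0) mulrDl addr_ge0//.
    exact: le_trans (normr_ge0 _) (hr _).
  exact: le_trans (normr_ge0 _) (hi _).
under eq_integral do rewrite EFinM.
rewrite ge0_integralZl//=; last 2 first.
- by apply/measurable_EFinP; apply: measurable_tprod; exact: measurable_invDsqr.
- by move=> t _; rewrite lee_fin tprod_ge0//; exact: invDsqr_ge0.
by rewrite it -EFinM ltry.
Qed.

Lemma Cc_bounded Omega f : Cc Omega f -> exists M, forall x, normc (f x) <= M.
Proof.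
move=> [[cr ci] cK _].
have [Mr hr] := continuous_compact_bounded cr cK
  (fun x nx => congr1 (@complex.Re R) (csupport_out nx)).
have [Mi hi] := continuous_compact_bounded ci cK
  (fun x nx => congr1 (@complex.Im R) (csupport_out nx)).
exists (Mr + Mi) => x; rewrite (le_trans (normc_le_add _))//.
exact: lerD (hr x) (hi x).
Qed.

End compact_support.

(** * Fourier inversion and multiplication by a test function *)

Section inversion.
Context {R : realType} {d : nat}.
Local Notation RM := (measurableTypeR R).
Local Notation normc := Normc.normc.
Local Notation lam := (@lebesgue_tuple R d).
Local Notation row := (@row_of_tuple R d).
Implicit Types (f g : 'rV[R]_d -> R[i]) (Omega : set 'rV[R]_d).

Lemma row_of_tupleK (t : d.-tuple RM) : tuple_of_row (row t) = t.
Proof. by apply: eq_from_tnth => i; rewrite tnth_mktuple mxE. Qed.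

Let lap (t : d.-tuple RM) : R := tprod (fun x : RM => expR (- `|x : R|)) t.
Let poisson (t : d.-tuple RM) : R := tprod (fun x : RM => 2 / (1 + (x : R) ^+ 2)) t.
Let z0 : d.-tuple RM := tuple_of_row 0.

Let lap_ge0 t : 0 <= lap t.
Proof. by apply: tprod_ge0 => x; exact: expR_ge0. Qed.

Let measurable_lap : measurable_fun setT lap.
Proof. by apply: measurable_tprod; exact: measurable_laplace. Qed.

Let integral_lap : (\int[lam]_t (lap t)%:E = (2 ^+ d)%:E)%E.
Proof.
apply: integral_tprod; [exact: measurable_laplace|by move=> x; exact: expR_ge0|].
exact: integral_laplace.
Qed.

Let k0_ge0 (x : RM) : 0 <= 2 / (1 + (x : R) ^+ 2).
Proof. by rewrite divr_ge0// addr_ge0 ?sqr_ge0. Qed.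

Let measurable_k0 : measurable_fun setT (fun x : RM => 2 / (1 + (x : R) ^+ 2)).
Proof. by apply: measurable_funM => //; exact: measurable_invDsqr. Qed.

Let poisson_ge0 t : 0 <= poisson t. Proof. exact: tprod_ge0. Qed.

Let measurable_poisson : measurable_fun setT poisson.
Proof. exact: measurable_tprod. Qed.

Let integral_poisson : (\int[lam]_t (poisson t)%:E = ((2 * pi) ^+ d)%:E)%E.
Proof.
apply: integral_tprod => //.
under eq_integral do rewrite EFinM.
rewrite ge0_integralZl//=; last 2 first.
- by apply/measurable_EFinP; exact: measurable_invDsqr.
- by move=> x _; rewrite lee_fin invDsqr_ge0.
by rewrite integral_invDsqr.
Qed.

Let cL1_poisson : cL1 lam (fun t => (poisson t)%:C%C).
Proof.
split; first exact: cmeas_real.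
under eq_integral do rewrite normc_real ger0_norm//.
by rewrite integral_poisson ltry.
Qed.

Let cint_poisson : cint lam (fun t => (poisson t)%:C%C) = ((2 * pi) ^+ d)%:C%C.
Proof. by rewrite /cint /= /Rintegral integral_poisson integral0. Qed.

Section summability.
Variables (f : 'rV[R]_d -> R[i]) (Omega : set 'rV[R]_d) (y : 'rV[R]_d).
Hypothesis fC : Cc Omega f.
Hypothesis Ffi : (\int[lam]_t (normc (fourier f (row t)))%:E < +oo)%E.

Let N n : R := n.+1%:R.
Let N_gt0 n : 0 < N n. Proof. by rewrite ltr0n. Qed.
Let NV_gt0 n : 0 < (N n)^-1. Proof. by rewrite invr_gt0. Qed.

Let laps n (s : d.-tuple RM) : R := lap (affine_tuple (N n)^-1 z0 s).

Let measurable_laps n : measurable_fun setT (laps n).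
Proof. exact: (measurableT_comp measurable_lap (@measurable_affine_tuple _ _ _ _)). Qed.

Let b n (s : d.-tuple RM) : R[i] := (laps n s)%:C%C * cis (dotp (row s) y).

Let normc_b n s : normc (b n s) = laps n s.
Proof.
rewrite Normc.normcM normc_cis mulr1 normc_real ger0_norm//.
exact: lap_ge0.
Qed.

Let cmeas_b n : cmeas (b n).
Proof.
apply: cmeasM; first exact: cmeas_real.
by apply: cmeas_cis; apply: measurable_dotp => i //; exact: measurable_row_of_tuple.
Qed.

Let cL1_b n : cL1 lam (b n).
Proof.
split => //; under eq_integral do rewrite normc_b.
have := @lebesgue_tuple_affine R d _ z0 (EFin \o lap) (NV_gt0 n).
rewrite [X in _ = X]integral_lap; set I := integral _ _ _ => h.
have : ((((N n)^-1) ^+ d)%:E * I = (2 ^+ d)%:E)%E.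
  apply: h => [|t]; [apply/measurable_EFinP; exact: measurable_lap|by rewrite /= lee_fin].
have : (0 <= I)%E by apply: integral_ge0 => t _; rewrite /= lee_fin.
change ((0 <= I)%E -> ((N n)^-1 ^+ d)%:E * I = (2 ^+ d)%:E -> I < +oo)%E.
case: I {h} => [r _ _|_|//]; first exact: ltry.
by rewrite gt0_muley ?lte_fin ?exprn_gt0.
Qed.

Let B n : 'rV[R]_d -> R[i] := superpose lam (b n) row.

Let BE n x : B n x =
  ((N n) ^+ d)%:C%C * (poisson (tuple_of_row (N n *: (x - y))))%:C%C.
Proof.
have mrow := @measurable_row_of_tuple R d.
rewrite /B /superpose -(cint_affine z0 (N_gt0 n) (cL1_superpose (cL1_b n) mrow x)).2.
congr (_ * _); rewrite -(cint_laplace_tuple _).2; apply: eq_cint => t /=.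
rewrite laplace_tupleE /b /laps.
have -> : affine_tuple (N n)^-1 z0 (affine_tuple (N n) z0 t) = t.
  apply: eq_from_tnth => i; rewrite !tnth_mktuple mxE !addr0.
  by rewrite mulrA mulVf ?mul1r// gt_eqF.
rewrite -mulrA -cisD; congr (_ * cis _).
have -> : \sum_(i < d) tnth (tuple_of_row (N n *: (x - y))) i * tnth t i =
    dotp (row t) (N n *: (x - y)).
  by rewrite dotpC; apply: eq_bigr => i _; rewrite tnth_mktuple !mxE.
rewrite row_of_tuple_affine tuple_of_rowK addr0.
rewrite (dotpC _ y) !dotpZr dotpDr dotpNr (dotpC (row t) x) (dotpC (row t) y).
ring.
Qed.

Let cvgNV : (N n)^-1 @[n --> \oo] --> (0 : R).
Proof. exact: cvg_harmonic. Qed.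

Let A n : R[i] := fourier (fun x => f x * B n x) 0.

Let fL : cL1row f := Cc_cL1row fC.

Let A_fourier n : A n = cint lam (fun s => b n s * fourier f (row s)).
Proof.
transitivity (cint lam (fun s => b n s * fourier f (0 + row s))).
  exact: (fourier_superpose (cL1_b n) (@measurable_row_of_tuple R d) 0 fL).
by apply: eq_cint => s; rewrite add0r.
Qed.

Let cvgA1 : normc (A n - cint lam (fun s => fourier f (row s) *
    cis (dotp (row s) y))) @[n --> \oo] --> (0 : R).
Proof.
have mF : cmeas (fun s => fourier f (row s)).
  by apply: cmeas_fourier => // i; exact: measurable_row_of_tuple.
have mc : cmeas (fun s => cis (dotp (row s) y)).
  by apply: cmeas_cis; apply: measurable_dotp => i //; exact: measurable_row_of_tuple.
under eq_fun do rewrite A_fourier.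
have lap1 n s : laps n s <= 1.
  rewrite /laps /lap /tprod; apply: prodr_ile1 => i _.
  by rewrite expR_ge0 -expR0 ler_expR oppr_le0 normr_ge0.
apply: (cint_cvg (G := fun s => normc (fourier f (row s)))) => //.
- by move=> n; exact: cmeasM.
- exact: cmeasM.
- exact: cmeas_normc.
- by move=> n s; rewrite Normc.normcM normc_b ler_piMl ?normc_ge0.
- by move=> s; rewrite Normc.normcM normc_cis mulr1.
move=> s.
have E n : normc (b n s * fourier f (row s) - fourier f (row s) * cis (dotp (row s) y))
   = `|expR (- ((N n)^-1 * \sum_i `|tnth s i|)) - 1| * normc (fourier f (row s)).
  rewrite (_ : _ - _ = ((laps n s - 1)%:C%C * cis (dotp (row s) y)) *
    fourier f (row s)); last by rewrite /b rmorphB /=; ring.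
  rewrite !Normc.normcM normc_cis mulr1 normc_real; congr (`|_ - 1| * _).
  rewrite /laps /lap /tprod -expR_sum; congr expR.
  rewrite mulr_sumr -sumrN; apply: eq_bigr => i _.
  by rewrite !tnth_mktuple mxE addr0 normrM (gtr0_norm (NV_gt0 n)).
rewrite (_ : (fun n => _) = (fun n => `|expR (- ((N n)^-1 * \sum_i `|tnth s i|)) - 1| *
   normc (fourier f (row s)))); last exact/funext.
rewrite -[X in _ --> X](mul0r (normc (fourier f (row s)))).
apply: cvgM; last exact: cvg_cst.
rewrite -[X in _ --> X](normr0 R); apply: cvg_norm.
rewrite -[X in _ --> X](subrr 1); apply: cvgB; last exact: cvg_cst.
rewrite -[X in _ --> X]expR0; apply: continuous_cvg; first exact: continuous_expR.
rewrite -[X in _ --> X]oppr0; apply: cvgN.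
rewrite -[X in _ --> X](mul0r (\sum_i `|tnth s i|)).
by apply: cvgM => //; exact: cvg_cst.
Qed.

Let cvgA2 : normc (A n - f y * ((2 * pi) ^+ d)%:C%C) @[n --> \oo] --> (0 : R).
Proof.
have [[cr ci] _ _] := fC; have [M fM] := Cc_bounded fC.
have mrow := @measurable_row_of_tuple R d.
pose sh n (u : d.-tuple RM) := affine_tuple (N n)^-1 (tuple_of_row y) u.
have AE n : A n = cint lam (fun u => f (row (sh n u)) * (poisson u)%:C%C).
  have BL : cL1row (fun x => f x * B n x) := cL1row_superpose (cL1_b n) mrow fL.
  rewrite /A fourierE.
  have -> : cint lam (fun t => f (row t) * B n (row t) * cis (- dotp (row t) 0)) =
      cint lam ((fun x => f x * B n x) \o row).
    apply: eq_cint => t; rewrite (_ : dotp (row t) 0 = 0) ?oppr0 ?cis0 ?mulr1//.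
    by rewrite -(scale0r (0 : 'rV[R]_d)) dotpZr mul0r.
  have [h1 <-] := cint_affine (tuple_of_row y) (NV_gt0 n) BL.
  rewrite -cintZ//; apply: eq_cint => u /=; rewrite BE -/(sh n u).
  have -> : tuple_of_row (N n *: (row (sh n u) - y)) = u.
    rewrite row_of_tuple_affine tuple_of_rowK addrK scalerA mulfV ?gt_eqF//.
    by rewrite scale1r row_of_tupleK.
  rewrite mulrCA; congr (_ * _); rewrite mulrA -rmorphM /=.
  by rewrite -exprMn mulVf ?expr1n ?mul1r// gt_eqF.
have -> : f y * ((2 * pi) ^+ d)%:C%C = cint lam (fun u => f y * (poisson u)%:C%C).
  by rewrite cintZ// cint_poisson.
rewrite (_ : (fun n => _) = (fun n => normc (cint lam (fun u =>
   f (row (sh n u)) * (poisson u)%:C%C) -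
   cint lam (fun u => f y * (poisson u)%:C%C)))); last first.
  by apply/funext => n; rewrite AE.
have M0 : 0 <= M by apply: le_trans (fM 0); exact: normc_ge0.
have mp := cmeas_real measurable_poisson.
have [mf _] := fL.
apply: (cint_cvg (G := fun u => M * poisson u)).
- move=> n; apply: cmeasM => //.
  exact: (cmeas_comp mf (@measurable_affine_tuple _ _ _ _)).
- by apply: (@cmeasM _ _ _ (fun=> f y)).
- exact: measurable_funM.
- under eq_integral do rewrite EFinM.
  rewrite ge0_integralZl//=; last 2 first.
  + exact/measurable_EFinP.
  + by move=> u _; rewrite lee_fin.
  by rewrite integral_poisson -EFinM ltry.
- by move=> n u; rewrite Normc.normcM normc_real (ger0_norm (poisson_ge0 u))
    ler_wpM2r.
- by move=> u; rewrite Normc.normcM normc_real (ger0_norm (poisson_ge0 u))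
    ler_wpM2r.
move=> u.
have path : row (sh n u) @[n --> \oo] --> y.
  rewrite (_ : (fun n => _) = (fun n => (N n)^-1 *: row u + y)); last first.
    by apply/funext => n; rewrite row_of_tuple_affine tuple_of_rowK.
  rewrite -[X in _ --> X]add0r; apply: cvgD; last exact: cvg_cst.
  by rewrite -[X in _ --> X](scale0r (row u)); apply: cvgZr_tmp.
have hr : complex.Re (f (row (sh n u))) @[n --> \oo] --> complex.Re (f y).
  exact: (cvg_comp _ _ path (cr y)).
have hi : complex.Im (f (row (sh n u))) @[n --> \oo] --> complex.Im (f y).
  exact: (cvg_comp _ _ path (ci y)).
have h : (`|complex.Re (f (row (sh n u))) - complex.Re (f y)| +
   `|complex.Im (f (row (sh n u))) - complex.Im (f y)|) * poisson u
     @[n --> \oo] --> (0 : R).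
  rewrite -[X in _ --> X](mul0r (poisson u)); apply: cvgM; last exact: cvg_cst.
  rewrite -[X in _ --> X](addr0 0); apply: cvgD.
    rewrite -[X in _ --> X](normr0 R); apply: cvg_norm.
    by rewrite -[X in _ --> X](subrr (complex.Re (f y))); apply: cvgB => //; exact: cvg_cst.
  rewrite -[X in _ --> X](normr0 R); apply: cvg_norm.
  by rewrite -[X in _ --> X](subrr (complex.Im (f y))); apply: cvgB => //; exact: cvg_cst.
apply: (@squeeze_cvgr _ _ _ _ (cst 0)) h; last exact: cvg_cst.
near=> n; rewrite normc_ge0 /= -mulrBl Normc.normcM normc_real.
rewrite (ger0_norm (poisson_ge0 u)) ler_wpM2r//.
apply: le_trans (normc_le_add _) _.
by case: (f _) => ? ?; case: (f y) => ? ?.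
Unshelve. all: by end_near. Qed.

(** Fourier inversion, by Abel summation: the damping factors e^{-|s_i|/n} turn
the inversion integral into the convolution of f with an approximate identity
made of Poisson kernels, and the two ways of writing the damped integral have
the two sides as limits. *)
Lemma fourier_inversion :
  cint lam (fun s => fourier f (row s) * cis (dotp (row s) y)) =
  f y * ((2 * pi) ^+ d)%:C%C.
Proof. exact: (normc_cvg_unique cvgA1 cvgA2). Qed.

End summability.

Lemma fnorm_lty_fourier sigma l f : weight sigma -> 0 <= l -> cL1row f ->
  (fnorm sigma l f < +oo)%E ->
  (\int[lam]_t (normc (fourier f (row t)))%:E < +oo)%E.
Proof.
move=> sW l0 fL; apply: le_lt_trans.
have mF : measurable_fun setT (fun s => normc (fourier f (row s))).
  apply: cmeas_normc; apply: cmeas_fourier => // i; exact: measurable_row_of_tuple.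
apply: ge0_le_integral => //=.
- by move=> t _; rewrite lee_fin normc_ge0.
- exact/measurable_EFinP.
- apply/measurable_EFinP; apply: measurable_funM => //.
  by apply: (measurable_wexp sW l) => i; exact: measurable_row_of_tuple.
- move=> t _; rewrite lee_fin ler_peMr ?normc_ge0//.
  by rewrite -expR0 ler_expR mulr_ge0// (weight_ge0 sW)// euclid_ge0.
Qed.

(** Multiplication by psi is bounded for the weighted norms, since psi is a
superposition of characters with density its Fourier transform. *)
Lemma fnorm_mul sigma l psi Omega : weight sigma -> 0 <= l -> Cc Omega psi ->
  (fnorm sigma l psi < +oo)%E ->
  exists2 c, 0 <= c & forall g, cL1row g -> (fnorm sigma l g < +oo)%E ->
    (fnorm sigma l (fun x => (psi x * g x)%R) <= c%:E * fnorm sigma l g)%E.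
Proof.
move=> sW l0 psiC psiN; have psiL := Cc_cL1row psiC.
have Fi := fnorm_lty_fourier sW l0 psiL psiN.
pose C : R := (2 * pi) ^+ d.
have C0 : 0 < C by rewrite exprn_gt0// mulr_gt0// pi_gt0.
have mrow := @measurable_row_of_tuple R d.
pose b (s : d.-tuple RM) : R[i] := (C^-1)%:C%C * fourier psi (row s).
have FL : cL1 lam (fun s => fourier psi (row s)) by split => //; exact: cmeas_fourier.
have bL : cL1 lam b by exact: cL1Z.
have mN i : measurable_fun setT (fun s => (- row s) 0 i).
  by under eq_fun do rewrite mxE; exact: measurableT_comp.
have psiE : superpose lam b (fun s => - row s) = psi.
  apply/funext => x; rewrite /superpose.
  transitivity (cint lam (fun s => (C^-1)%:C%C *
      (fourier psi (row s) * cis (dotp (row s) x)))).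
    by apply: eq_cint => s; rewrite dotpNr opprK dotpC mulrA.
  rewrite cintZ; last first.
    split; first apply: cmeasM; first by case: FL.
      by apply: cmeas_cis; apply: measurable_dotp.
    by under eq_integral do rewrite Normc.normcM normc_cis mulr1.
  rewrite (fourier_inversion x psiC Fi) mulrCA -rmorphM /= mulVf ?gt_eqF//.
  by rewrite mulr1.
pose I := fine (\int[lam]_s (normc (b s) * wexp sigma l (- row s))%:E)%E.
have IE : (\int[lam]_s (normc (b s) * wexp sigma l (- row s))%:E = I%:E)%E.
  rewrite fineK// ge0_fin_numE; last first.
    by apply: integral_ge0 => s _; rewrite lee_fin mulr_ge0 ?normc_ge0 ?wexp_ge0.
  under eq_integral => s _.
    rewrite /b Normc.normcM wexpN normc_real -mulrA EFinM; over.
  rewrite /= ge0_integralZl//=; last 2 first.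
  - apply/measurable_EFinP; apply: measurable_funM.
      by apply: cmeas_normc; case: FL.
    exact: measurable_wexp.
  - by move=> s _; rewrite lee_fin mulr_ge0 ?normc_ge0 ?wexp_ge0.
  by rewrite lte_mul_pinfty ?lee_fin.
exists (2 * I) => [|g gL gN].
  rewrite mulr_ge0// -lee_fin -IE; apply: integral_ge0 => s _.
  by rewrite lee_fin mulr_ge0 ?normc_ge0 ?wexp_ge0.
rewrite EFinM -muleA -IE.
have -> : (fun x => psi x * g x) =
    (fun x => g x * superpose lam b (fun s => - row s) x).
  by apply/funext => x; rewrite psiE mulrC.
exact: fnorm_superpose.
Qed.

End inversion.

(** * Growth of weights *)

Section right_neighborhood.
Context {R : realType}.

Lemma near0P (P : R -> Prop) :
  (\forall e \near 0^'+, P e) <->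
  exists2 d : R, 0 < d & forall e, 0 < e -> e < d -> P e.
Proof.
split=> [[d /= d0 dP]|[d d0 dP]].
  exists d => // e e0 ed; apply: dP => //=.
  by rewrite sub0r normrN gtr0_norm.
near=> e; apply: dP; first by near: e; exact: nbhs_right_gt.
by near: e; exact: nbhs_right_lt.
Unshelve. all: by end_near. Qed.

End right_neighborhood.

Section weight_growth.
Context {R : realType}.
Local Notation RM := (measurableTypeR R).
Variable omega : R -> R.
Hypothesis omegaW : weight omega.

(** The growth condition on weights, in additive form: e^omega dominates all powers. *)
Lemma weight_ge_ln (M : R) : 0 <= M ->
  exists C, forall t, 0 <= t -> M * ln (1 + t) <= omega t + C.
Proof.
move=> M0; have /cvgryPge /(_ M) := weight_log omegaW.
move=> [T [Treal hT]].
pose T' := Num.max T 0 + 1.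
have T'0 : 0 <= T' by rewrite /T' addr_ge0// le_max lexx orbT.
exists (M * ln (1 + T')) => t t0; have [tT|Tt] := leP t T'.
  rewrite ler_wpDl ?(weight_ge0 omegaW)// ler_wpM2l//.
  by rewrite ler_ln ?posrE ?ltr_pwDl// lerD2l.
have T't : 0 < ln (1 + t) by rewrite ln_gt0// ltrDl (le_lt_trans T'0).
rewrite ler_wpDr//.
  by rewrite mulr_ge0// ln_ge0// lerDl.
have : M <= omega t / ln (1 + t).
  apply: hT; apply: le_lt_trans Tt; rewrite /T' -[leLHS]addr0.
  by rewrite lerD// le_max lexx.
by rewrite ler_pdivlMr.
Qed.

(** The relation << in additive form: the constant absorbs the values at bounded
arguments. *)
Lemma weight_ll_le omega1 (delta : R) : weight omega1 -> weight_ll omega1 omega ->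
  0 < delta -> exists C, forall t, 0 <= t -> omega1 t <= delta * omega t + C.
Proof.
move=> o1W ll d0; have [T [Treal hT]] := ll _ d0.
pose T' := Num.max T 0 + 1.
have T'0 : 0 <= T' by rewrite /T' addr_ge0// le_max lexx orbT.
exists (omega1 T') => t t0; have [tT|Tt] := leP t T'.
  by rewrite ler_wpDl ?mulr_ge0 ?(weight_ge0 omegaW) ?(ltW d0)// (weight_nd o1W).
rewrite ler_wpDr ?(weight_ge0 o1W)//.
have : (`|(EFin \o omega1) t| <= (delta * `|omega t|)%:E)%E.
  apply: hT; apply: le_lt_trans Tt; rewrite /T' -[leLHS]addr0.
  by rewrite lerD// le_max lexx.
rewrite /= lee_fin (ger0_norm (weight_ge0 omegaW t0)).
by rewrite (ger0_norm (weight_ge0 o1W t0)).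
Qed.

Lemma weight_near0_ge (A : R) : \forall e \near 0^'+, A <= omega e^-1.
Proof.
have [C hC] := weight_ge_ln (ler01 : 0 <= 1 :> R).
apply/near0P; exists (expR (- `|A + C|)) => [|e e0 eA]; first exact: expR_gt0.
have h : `|A + C| <= ln (1 + e^-1).
  rewrite -ler_expR lnK ?posrE ?ltr_pwDl// ?invr_ge0 ?(ltW e0)//.
  rewrite ler_wpDl// -[expR _]invrK lef_pV2 ?posrE ?invr_gt0 ?expR_gt0//.
  by rewrite -expRN ltW.
have := hC e^-1; rewrite mul1r => /(_ _).
rewrite invr_ge0 => /(_ (ltW e0)) h2.
have := le_trans (le_trans (ler_norm (A + C)) h) h2.
by rewrite lerD2r.
Qed.

(** Half of a omega absorbs b omega1, up to a constant, and the other half dominates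
2 d ln(1 + |x|), which leaves the product of the 1 / (1 + x_i^2). *)
Lemma integral_wexp_lty d (a b : R) omega1 : weight omega1 ->
  weight_ll omega1 omega -> 0 < a -> 0 <= b ->
  (\int[lebesgue_tuple d]_t
     (wexp omega (- a) (row_of_tuple t) * wexp omega1 b (row_of_tuple t))%:E
   < +oo)%E.
Proof.
move=> o1W ll a0 b0.
have mrow := @measurable_row_of_tuple R d.
have [C1 hC1] : exists C, forall t, 0 <= t -> b * omega1 t <= a / 2 * omega t + C.
  have b1 : 0 < b + 1 by rewrite ltr_wpDl.
  have ab : 0 < a / 2 / (b + 1) by rewrite !divr_gt0.
  have [C hC] := weight_ll_le o1W ll ab.
  exists (`|(b + 1) * C|) => t t0.
  apply: (@le_trans _ _ ((b + 1) * omega1 t)).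
    by rewrite ler_wpM2r ?(weight_ge0 o1W)// lerDl.
  apply: (@le_trans _ _ ((b + 1) * (a / 2 / (b + 1) * omega t + C))).
    by rewrite ler_wpM2l ?(ltW b1)// hC.
  rewrite mulrDr mulrA mulrCA mulfV ?gt_eqF// mulr1 lerD2l.
  exact: ler_norm.
have [C2 hC2] : exists C, forall t, 0 <= t ->
    (2 * d)%:R * ln (1 + t) <= a / 2 * omega t + C.
  have a20 : 0 < a / 2 by rewrite divr_gt0.
  have [|C hC] := @weight_ge_ln ((2 * d)%:R / (a / 2)).
    by rewrite divr_ge0 ?ler0n ?(ltW a20).
  exists (a / 2 * C) => t t0; rewrite -mulrDr.
  rewrite -(@ler_pM2l _ (a / 2)^-1) ?invr_gt0// mulKf ?gt_eqF//.
  by rewrite mulrA (mulrC _ (2 * d)%:R) hC.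
pose W (t : d.-tuple RM) := tprod (fun x : RM => (1 + (x : R) ^+ 2)^-1) t.
have mW : measurable_fun setT W by apply: measurable_tprod; exact: measurable_invDsqr.
have W0 t : 0 <= W t by apply: tprod_ge0 => x; exact: invDsqr_ge0.
have key t : wexp omega (- a) (row_of_tuple t) * wexp omega1 b (row_of_tuple t) <=
    expR (C1 + C2) * W t.
  set e := euclid (row_of_tuple t); have e0 : 0 <= e by exact: euclid_ge0.
  have e1 : 0 < 1 + e by rewrite ltr_pwDl.
  rewrite /wexp -expRD -/e.
  apply: (@le_trans _ _ (expR (C1 + C2 - (2 * d)%:R * ln (1 + e)))).
    rewrite ler_expR; have := hC1 _ e0; have := hC2 _ e0.
    have -> : - a * omega e = - (a / 2 * omega e) - a / 2 * omega e by field.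
    by lra.
  rewrite expRD ler_wpM2l ?expR_ge0// expRN mulr_natl -lnXn// lnK ?posrE ?exprn_gt0//.
  rewrite /W /tprod prodfV lef_pV2 ?posrE ?exprn_gt0//; last first.
    by apply: prodr_gt0 => i _; rewrite ltr_pwDl// sqr_ge0.
  rewrite exprM -[X in _ ^+ X](card_ord d) -prodr_const; apply: ler_prod => i _.
  rewrite addr_ge0 ?sqr_ge0//= sqrrD expr1n mul1r.
  have : (tnth t i) ^+ 2 <= e ^+ 2.
    rewrite -(real_normK (num_real (tnth t i))) lerXn2r ?nnegrE//.
    by have := coord_le_euclid (row_of_tuple t) i; rewrite mxE.
  have : 0 <= e *+ 2 by rewrite mulrn_wge0.
  by lra.
apply: (@le_lt_trans _ _ (\int[lebesgue_tuple d]_t ((expR (C1 + C2))%:E * (W t)%:E))%E).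
  apply: ge0_le_integral => //=.
  - by move=> t _; rewrite lee_fin mulr_ge0 ?wexp_ge0.
  - apply/measurable_EFinP; apply: measurable_funM; last exact: measurable_wexp.
    exact: measurable_wexp.
  - by apply/measurable_EFinP; exact: measurable_funM.
  - by move=> t _; rewrite lee_fin.
rewrite ge0_integralZl//=; last 2 first.
- exact/measurable_EFinP.
- by move=> t _; rewrite lee_fin.
rewrite (integral_tprod _ measurable_invDsqr invDsqr_ge0 integral_invDsqr).
by rewrite -EFinM ltry.
Qed.

End weight_growth.

(** * Continuity of superpositions and the gliding hump *)

Section superpose_continuity.
Context {R : realType} {d : nat}.
Local Notation normc := Normc.normc.

Lemma lipschitz_deriv_le1 (f df : R -> R) : (forall x : R, is_derive x 1 f (df x)) ->
  (forall x, `|df x| <= 1) -> forall s t, `|f s - f t| <= `|s - t|.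
Proof.
move=> fd df1 s t; wlog st : s t / s <= t.
  move=> h; have [/h//|/ltW/h] := leP s t.
  by rewrite distrC [leRHS]distrC.
have cf : {within `[s, t], continuous f}.
  apply: continuous_subspaceT => x; apply/differentiable_continuous/derivable1_diffP.
  exact: (@ex_derive _ _ _ _ _ _ _ (fd x)).
have [c _ E] := MVT_segment st (fun x _ => fd x) cf.
by rewrite distrC E normrM [leRHS]distrC ler_piMl.
Qed.

Lemma normc_cisB (s t : R) : normc (cis s - cis t) <= 2 * `|s - t|.
Proof.
apply: le_trans (normc_le_add _) _; rewrite mulr_natl mulr2n; apply: lerD => /=.
  apply: (lipschitz_deriv_le1 (f := cos) (df := fun x => - sin x)) => x.
  by rewrite normrN sin_max.
apply: (lipschitz_deriv_le1 (f := sin) (df := cos)) => x.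
exact: cos_max.
Qed.

Lemma dotp_le_euclid (x y : 'rV[R]_d) : `|dotp x y| <= euclid x * euclid y.
Proof.
by rewrite -sqrtrM ?dotp_ge0// -sqrtr_sqr ler_wsqrtr// cauchy_schwarz.
Qed.

Lemma euclid_continuous (x : 'rV[R]_d) : euclid (y - x) @[y --> x] --> (0 : R).
Proof.
have c (s : seq 'I_d) :
    {for x, continuous (fun y : 'rV[R]_d => \sum_(i <- s) (y 0 i - x 0 i) * (y 0 i - x 0 i))}.
  elim: s => [|j s IH].
    rewrite (_ : (fun y => _) = fun=> 0); first exact: cst_continuous.
    by apply/funext => y; rewrite big_nil.
  rewrite (_ : (fun y => _) = (fun y : 'rV[R]_d => (y 0 j - x 0 j) * (y 0 j - x 0 j) +
     \sum_(i <- s) (y 0 i - x 0 i) * (y 0 i - x 0 i))); last first.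
    by apply/funext => y; rewrite big_cons.
  pose co (y : 'rV[R]_d) : R := y 0 j.
  have c1 : {for x, continuous co} by exact: coord_continuous.
  have c2 : {for x, continuous ((fun=> x 0 j : R) : 'rV[R]_d -> R)}.
    exact: cst_continuous.
  have c3 := continuousB c1 c2.
  exact: (continuousD (continuousM c3 c3) IH).
have e y : euclid (y - x) =
    Num.sqrt (\sum_(i <- index_enum 'I_d) (y 0 i - x 0 i) * (y 0 i - x 0 i)).
  by congr Num.sqrt; apply: eq_bigr => i _; rewrite !mxE.
rewrite (_ : (fun y => _) = (fun y : 'rV[R]_d =>
    Num.sqrt (\sum_(i <- index_enum 'I_d) (y 0 i - x 0 i) * (y 0 i - x 0 i)))); last first.
  exact/funext.
rewrite [X in _ --> X](_ : 0 =
    Num.sqrt (\sum_(i <- index_enum 'I_d) (x 0 i - x 0 i) * (x 0 i - x 0 i))); last first.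
  by rewrite big1 ?sqrtr0// => i _; rewrite subrr mul0r.
exact: (cvg_comp _ _ (c (index_enum 'I_d)) (@sqrt_continuous R _)).
Qed.

Context d' (S : measurableType d') (nu : {sigma_finite_measure set S -> \bar R}).
Variables (b : S -> R[i]) (p : S -> 'rV[R]_d).
Hypothesis bL : cL1 nu b.
Hypothesis mp : forall i, measurable_fun setT (fun s => p s 0 i).
Hypothesis bp : (\int[nu]_s (normc (b s) * euclid (p s))%:E < +oo)%E.

(** A character is Lipschitz with constant |p(s)|, up to a factor 2, so that a
superposition with a first moment is Lipschitz. *)
Lemma superpose_ccontinuous : ccontinuous (superpose nu b p).
Proof.
have [mb _] := bL.
have me : measurable_fun setT (fun s => euclid (p s)).
  apply: (@measurableT_comp _ _ _ _ _ _ (@Num.sqrt R)).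
    by apply: continuous_measurable_fun; exact: sqrt_continuous.
  exact: measurable_dotp.
pose I := fine (\int[nu]_s (normc (b s) * euclid (p s))%:E)%E.
have IE : (\int[nu]_s (normc (b s) * euclid (p s))%:E = I%:E)%E.
  rewrite fineK// ge0_fin_numE//; apply: integral_ge0 => s _.
  by rewrite lee_fin mulr_ge0 ?normc_ge0 ?euclid_ge0.
have lip x y : normc (superpose nu b p x - superpose nu b p y) <=
    4 * I * euclid (y - x).
  have xL := cL1_superpose bL mp x; have yL := cL1_superpose bL mp y.
  rewrite /superpose -cintB//.
  have mB : cmeas (fun s => b s * cis (- dotp x (p s)) - b s * cis (- dotp y (p s))).
    by apply: cmeasB; [case: xL|case: yL].
  have bound s : normc (b s * cis (- dotp x (p s)) - b s * cis (- dotp y (p s))) <=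
      2 * euclid (y - x) * (normc (b s) * euclid (p s)).
    rewrite -mulrBr Normc.normcM mulrCA ler_wpM2l ?normc_ge0//.
    apply: le_trans (normc_cisB _ _) _; rewrite -mulrA ler_wpM2l//.
    by rewrite opprK addrC (dotpC y) (dotpC x) -dotpNr -dotpDr dotpC dotp_le_euclid.
  have L : (\int[nu]_s (2 * euclid (y - x) * (normc (b s) * euclid (p s)))%:E =
      (2 * euclid (y - x) * I)%:E)%E.
    under eq_integral do rewrite EFinM.
    rewrite ge0_integralZl//=; last 3 first.
    - apply/measurable_EFinP; apply: measurable_funM => //; exact: cmeas_normc.
    - by move=> s _; rewrite lee_fin mulr_ge0 ?normc_ge0 ?euclid_ge0.
    - by rewrite lee_fin mulr_ge0 ?euclid_ge0.
    by rewrite IE -EFinM.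
  have BL : cL1 nu (fun s => b s * cis (- dotp x (p s)) - b s * cis (- dotp y (p s))).
    apply: (cL1_le mB _ bound); last by rewrite L ltry.
    by apply: measurable_funM => //; apply: measurable_funM => //; exact: cmeas_normc.
  rewrite -lee_fin; apply: le_trans (normc_cint BL) _.
  apply: (@le_trans _ _ (2%:E * (2 * euclid (y - x) * I)%:E)%E).
    rewrite lee_wpmul2l//; rewrite -L; apply: ge0_le_integral => //=.
    - by move=> s _; rewrite lee_fin normc_ge0.
    - by apply/measurable_EFinP; exact: cmeas_normc.
    - apply/measurable_EFinP; apply: measurable_funM => //.
      by apply: measurable_funM => //; exact: cmeas_normc.
    - by move=> s _; rewrite lee_fin.
  by rewrite -EFinM lee_fin le_eqVlt; apply/orP; left; apply/eqP; ring.
have cvg0 (x : 'rV[R]_d) : 4 * I * euclid (y - x) @[y --> x] --> (0 : R).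
  rewrite -[X in _ --> X](mulr0 (4 * I)); exact: (cvgM (cvg_cst (4 * I)) (euclid_continuous x)).
have lip_continuous (g : 'rV[R]_d -> R) :
    (forall x y, `|g x - g y| <= 4 * I * euclid (y - x)) -> continuous g.
  move=> hg x; apply/(@cvgrPdist_lt _ _ _ (nbhs x) (nbhs_filter x)) => e e0.
  have h := @cvgr_lt _ _ (nbhs x) (nbhs_filter x) _ _ (cvg0 x) _ e0.
  by apply: filterS h => y; exact: le_lt_trans (hg x y).
split; apply: lip_continuous => x y; apply: le_trans (lip x y).
  apply: le_trans (Re_le_normc _).
  by case: (superpose _ _ _ x) => ? ?; case: (superpose _ _ _ y) => ? ?.
apply: le_trans (Im_le_normc _).
by case: (superpose _ _ _ x) => ? ?; case: (superpose _ _ _ y) => ? ?.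
Qed.

End superpose_continuity.

Section counting_geometric.
Context {R : realType}.
Implicit Types g : nat -> R.

Let q : R := 3^-1.
Let q0 : 0 < q. Proof. by rewrite invr_gt0. Qed.
Let qk k : 0 <= q ^+ k. Proof. exact/exprn_ge0/ltW. Qed.

Lemma sum_geometric_third k m :
  \sum_(j < m) q ^+ (k + j) = 3 / 2 * (q ^+ k - q ^+ (k + m)).
Proof.
elim: m => [|m IH]; first by rewrite big_ord0 addn0 subrr mulr0.
by rewrite big_ord_recr /= IH addnS exprS /q; field.
Qed.

Lemma counting_ge0_lty g (C : R) : (forall k, 0 <= g k <= C * q ^+ k) ->
  (\int[counting]_k (g k)%:E < +oo)%E.
Proof.
move=> gC; rewrite ge0_integral_count; last first.
  by move=> k; rewrite lee_fin; case/andP: (gC k).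
apply: (@le_lt_trans _ _ (C * (3 / 2))%:E); last exact: ltry.
apply: lime_le.
  by apply: is_cvg_nneseries => k _ _; rewrite lee_fin; case/andP: (gC k).
apply: nearW => n; rewrite sumEFin lee_fin big_mkord.
apply: (@le_trans _ _ (\sum_(k < n) C * q ^+ k)).
  by apply: ler_sum => k _; case/andP: (gC k).
have C0 : 0 <= C.
  by case/andP: (gC 0%N) => h1 h2; have := le_trans h1 h2; rewrite expr0 mulr1.
rewrite -mulr_sumr ler_wpM2l//; have := sum_geometric_third 0 n.
under eq_bigr do rewrite add0n.
move=> ->; rewrite ler_piMr ?divr_ge0// expr0 add0n lerBlDr lerDl.
by rewrite qk.
Qed.

Let counting_ge0_cvg g (C : R) : (forall k, 0 <= g k <= C * q ^+ k) ->
  \sum_(k < m) g k @[m --> \oo] --> \int[@counting nat R]_k g k.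
Proof.
move=> gC; have fin := counting_ge0_lty gC.
have g0 k : (0 <= (g k)%:E)%E by rewrite lee_fin; case/andP: (gC k).
have cv := @is_cvg_nneseries _ (fun k => (g k)%:E) xpredT 0%N (fun n _ _ => g0 n).
rewrite (_ : (fun m => _) = fine \o (fun m => \sum_(0 <= k < m) (g k)%:E)%E); last first.
  by apply/funext => m /=; rewrite sumEFin big_mkord.
apply: fine_cvg; rewrite fineK; last first.
  by rewrite ge0_fin_numE//; apply: integral_ge0.
by rewrite ge0_integral_count//; apply/cvg_ex; exists (limn (fun m => \sum_(0 <= k < m) (g k)%:E)%E).
Qed.

Lemma counting_integrable g (C : R) : (forall k, `|g k| <= C * q ^+ k) ->
  (@counting nat R).-integrable setT (EFin \o g).
Proof.
move=> gC; apply/integrableP; split => //=.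
by apply: (@counting_ge0_lty (fun k => `|g k|) C) => k; rewrite normr_ge0 gC.
Qed.

(** Absolute convergence: g is the difference of the nonnegative g + |g| and |g|. *)
Lemma counting_cvg g (C : R) : (forall k, `|g k| <= C * q ^+ k) ->
  \sum_(k < m) g k @[m --> \oo] --> \int[@counting nat R]_k g k.
Proof.
move=> gC.
have n1 k : 0 <= `|g k| <= C * q ^+ k by rewrite normr_ge0 gC.
have n2 k : 0 <= g k + `|g k| <= (2 * C) * q ^+ k.
  have := gC k; have := ler_norm (g k); have := ler_norm (- g k); rewrite normrN.
  move=> h1 h2 h3; apply/andP; split; first lra.
  have -> : 2 * C * q ^+ k = C * q ^+ k + C * q ^+ k by ring.
  lra.
have -> : \int[@counting nat R]_k g k =
    \int[@counting nat R]_k (g k + `|g k|) - \int[@counting nat R]_k `|g k|.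
  rewrite -RintegralB//; first by apply: eq_Rintegral => k _; rewrite addrK.
    by apply: (@counting_integrable _ (2 * C)) => k; case/andP: (n2 k) => h1 h2;
      rewrite ger0_norm.
  by apply: (@counting_integrable _ C) => k; rewrite normr_id.
rewrite (_ : (fun m => _) = (fun m => \sum_(k < m) (g k + `|g k|) - \sum_(k < m) `|g k|)).
  by apply: cvgB; [exact: counting_ge0_cvg n2|exact: counting_ge0_cvg n1].
by apply/funext => m; rewrite -sumrB; apply: eq_bigr => k _; rewrite addrK.
Qed.

(** The gliding hump with signs: whatever the partial sum x, one of x + y and
x - y is at least as large as y, so that signs can be chosen one after the other
such that, in the row n_k, the sum of the first k + 1 terms is at least as large
as the last of them. The factors 3^-k make the tail smaller than this. *)
Lemma gliding_hump (M : nat -> nat -> R) :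
  (forall n, exists B, forall i, `|M n i| <= B) ->
  (forall A N, exists n i, (N <= n)%N /\ A < `|M n i|) ->
  exists (sg : nat -> R) (ix : nat -> nat), (forall k, `|sg k| <= 1) /\
    forall N, exists2 n, (N <= n)%N &
      1 < `|\int[@counting nat R]_k (sg k * q ^+ k * M n (ix k))|.
Proof.
move=> Mb Mu.
(* A row, an index and a bound for the row. The entry reaches 3/4 of the bound,
   and the tail after the k-th term has at most 1/3 + 1/9 + ... = 1/2 of it, all
   of this multiplied by 3^-k: a quarter of 8 remains. *)
have : forall k, exists z : nat * nat * R, [/\ (k <= z.1.1)%N,
    8 / q ^+ k < z.2, forall i, `|M z.1.1 i| <= z.2 & 3 / 4 * z.2 <= `|M z.1.1 z.1.2|].
  move=> k; have [n [i [kn Mni]]] := Mu (8 / q ^+ k) k.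
  pose E := [set `|M n j| | j in [set: nat]].
  have hE : has_sup E.
    split; first by exists `|M n 0%N|, 0%N.
    by have [B hB] := Mb n; exists B => _ [j _ <-].
  have ub j : `|M n j| <= sup E by apply: sup_upper_bound => //; exists j.
  have s0 : 8 / q ^+ k < sup E by apply: lt_le_trans Mni (ub i).
  have s1 : 0 < sup E by apply: le_lt_trans s0; rewrite divr_ge0 ?qk.
  have e0 : 0 < sup E / 4 by rewrite divr_gt0.
  have [_ [j _ <-] hj] := sup_adherent e0 hE.
  exists (n, j, sup E); split => //=; apply: ltW; apply: le_lt_trans hj.
  by rewrite le_eqVlt; apply/orP; left; apply/eqP; field.
move=> /choice[z hz].
pose ix k := (z k).1.2; pose n_ k := (z k).1.1; pose B k := (z k).2.
pose sgn k (f : nat -> R) : R :=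
  if q ^+ k * `|M (n_ k) (ix k)| <= `|f (n_ k) + q ^+ k * M (n_ k) (ix k)| then 1 else -1.
pose pr := fix pr k := if k is k'.+1 then
  (fun n => pr k' n + sgn k' (pr k') * q ^+ k' * M n (ix k')) else (fun=> 0).
pose sg k := sgn k (pr k).
have sg1 k : `|sg k| <= 1 by rewrite /sg /sgn; case: ifP; rewrite ?normrN normr1.
have prE k n : pr k n = \sum_(j < k) sg j * q ^+ j * M n (ix j).
  elim: k => [|k IH] /=; first by rewrite big_ord0.
  by rewrite big_ord_recr /= IH.
have hump k : q ^+ k * `|M (n_ k) (ix k)| <= `|pr k.+1 (n_ k)|.
  rewrite /= /sgn; case: ifPn => [h|]; first by rewrite mul1r.
  rewrite -ltNge mulN1r mulNr => h.
  set y := q ^+ k * M _ _ in h *; set x := pr k (n_ k) in h *.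
  have yE : `|y| = q ^+ k * `|M (n_ k) (ix k)|.
    by rewrite normrM ger0_norm// qk.
  rewrite -yE in h *.
  have : `|y *+ 2| <= `|x + y| + `|x - y|.
    have -> : y *+ 2 = (x + y) - (x - y) by ring.
    exact: ler_normB.
  rewrite normrMn mulr2n; lra.
exists sg, ix; split => // N.
have [kn sB bB hB] := hz N.
exists (n_ N) => //.
have B0 : 0 < B N by apply: le_lt_trans sB; rewrite divr_ge0 ?qk.
have qN : 0 < q ^+ N by rewrite exprn_gt0.
have low : 2 < q ^+ N * B N / 4.
  move: sB; rewrite ltr_pdivrMr// mulrC -/(B N) => sB.
  by rewrite ltr_pdivlMr//; lra.
have tail m : `|\sum_(j < N.+1 + m) sg j * q ^+ j * M (n_ N) (ix j)| >=
    q ^+ N * B N / 4.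
  rewrite big_split_ord /= -prE.
  set T := (X in pr _ _ + X).
  have Tle : `|T| <= B N * (q ^+ N / 2).
    apply: le_trans (ler_norm_sum _ _ _) _.
    apply: (@le_trans _ _ (\sum_(j < m) q ^+ (N.+1 + j) * B N)).
      apply: ler_sum => j _; rewrite !normrM.
      apply: ler_pM; rewrite ?mulr_ge0//.
      rewrite [`|q ^+ _|]ger0_norm ?qk//.
      by rewrite ler_piMl// qk.
    rewrite -mulr_suml sum_geometric_third mulrC ler_wpM2l ?(ltW B0)//.
    have : 0 <= q ^+ (N.+1 + m) by rewrite qk.
    have -> : q ^+ N.+1 = q ^+ N / 3 by rewrite exprS mulrC.
    by lra.
  have h1 := hump N; have h2 : `|pr N.+1 (n_ N)| <= `|pr N.+1 (n_ N) + T| + `|T|.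
    by rewrite -{1}(addrK T (pr _ _)) ler_normB.
  have h3 : q ^+ N * (3 / 4 * B N) <= q ^+ N * `|M (n_ N) (ix N)|.
    by rewrite ler_wpM2l// ltW.
  have e1 : q ^+ N * (3 / 4 * B N) = 3 * (q ^+ N * B N / 4) by field.
  have e2 : B N * (q ^+ N / 2) = 2 * (q ^+ N * B N / 4) by field.
  rewrite e1 in h3; rewrite e2 in Tle; lra.
have cv : `|\sum_(k < m) sg k * q ^+ k * M (n_ N) (ix k)| @[m --> \oo] -->
    `|\int[@counting nat R]_k (sg k * q ^+ k * M (n_ N) (ix k))|.
  apply: cvg_norm; apply: (@counting_cvg _ (B N)) => k.
  rewrite !normrM mulrC; apply: ler_pM; rewrite ?mulr_ge0//.
  rewrite [`|q ^+ _|]ger0_norm ?qk//.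
  by rewrite ler_piMl// qk.
apply: (@lt_le_trans _ _ (q ^+ N * B N / 4)); first by apply: lt_trans low; rewrite ltr1n.
apply: (ler_cvg_to (cvg_cst (q ^+ N * B N / 4)) cv); near=> m.
have Nm : (N.+1 <= m)%N by near: m; exact: nbhs_infty_ge.
by rewrite -(subnKC Nm); exact: tail.
Unshelve. all: by end_near. Qed.

End counting_geometric.

(** * Uniform decay of the localized Fourier transforms *)

(** Sigma-finiteness of the counting measure, in the form required by Fubini. *)
HB.instance Definition _ (R : realType) :=
  @Measure_isSigmaFinite.Build _ _ _ (@counting nat R) (sigma_finite_counting R).

Section uniform_bound.
Context {R : realType} {d : nat}.
Local Notation normc := Normc.normc.
Local Notation lam := (@lebesgue_tuple R d).
Implicit Types (f g : 'rV[R]_d -> R[i]).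

Lemma fourier0 f : fourier f 0 = cintegral f.
Proof.
rewrite /fourier; congr cintegral; apply/funext => x.
by rewrite -(scale0r (0 : 'rV[R]_d)) dotpZr mul0r oppr0 cis0 mulr1.
Qed.

Lemma ccontinuousM f g : ccontinuous f -> ccontinuous g ->
  ccontinuous (fun x => f x * g x).
Proof.
move=> [fr fi] [gr gi]; split => x.
  rewrite (_ : (fun x => _) = (fun x => complex.Re (f x) * complex.Re (g x) -
     complex.Im (f x) * complex.Im (g x))).
    exact: (continuousB (continuousM (fr x) (gr x)) (continuousM (fi x) (gi x))).
  by apply/funext => y; rewrite Re_mulc.
rewrite (_ : (fun x => _) = (fun x => complex.Re (f x) * complex.Im (g x) +
   complex.Im (f x) * complex.Re (g x))).
  exact: (continuousD (continuousM (fr x) (gi x)) (continuousM (fi x) (gr x))).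
by apply/funext => y; rewrite Im_mulc.
Qed.

Lemma Cc_mul Omega f g : Cc Omega f -> ccontinuous g ->
  Cc Omega (fun x => f x * g x).
Proof.
move=> [fc fK fO] gc.
have sub : csupport (fun x => f x * g x) `<=` csupport f.
  apply: closure_subset => x /=; apply: contra_neq => ->; exact: mul0r.
split; [exact: ccontinuousM| |exact: subset_trans fO].
by apply: subclosed_compact fK sub; exact: closed_closure.
Qed.

Variables (Omega : set 'rV[R]_d) (omega omega1 : R -> R).
Variables (psi : 'rV[R]_d -> R[i]) (h : R -> 'rV[R]_d -> R[i]).
Hypotheses (oW : weight omega) (o1W : weight omega1).
Hypotheses (psiD : Dbeurling omega1 Omega psi).
Hypothesis hC : forall eps, 0 < eps < 1 -> Cc Omega (fun x => psi x * h eps x).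
Hypothesis h0 : forall rho, Dbeurling omega1 Omega rho ->
  cnet_zero omega (fun eps => pairing (h eps) rho).

Let a eps xi := fourier (fun x => psi x * h eps x) xi.

Let q : R := 3^-1.
Let qk k : 0 <= q ^+ k. Proof. by rewrite exprn_ge0// invr_ge0. Qed.

Lemma near0_violation (Q : R -> 'rV[R]_d -> Prop) (A : R) (e0 : R) : 0 < e0 ->
  ~ (\forall eps \near 0^'+, forall xi, Q eps xi) ->
  exists z : R * 'rV[R]_d,
    [/\ 0 < z.1 < 1, z.1 < e0, A <= omega z.1^-1 & ~ Q z.1 z.2].
Proof.
move=> e0_gt0 nQ; apply: contrapT => no; apply: nQ; near=> eps => xi.
apply: contrapT => nQ; apply: no; exists (eps, xi); split => //=.
- apply/andP; split; first by near: eps; exact: nbhs_right_gt.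
  by near: eps; apply: nbhs_right_lt.
- by near: eps; exact: weight_near0_ge.
Unshelve. all: by end_near. Qed.

(** Characters xi_k with coefficients b_k that decay faster than every power of
e^{omega1 |xi_k|}, up to a geometric factor, superpose to a test function. *)
Lemma Dbeurling_superpose (b : nat -> R[i]) (p : nat -> 'rV[R]_d) :
  (forall m, 0 < m ->
    exists C, forall k, normc (b k) * wexp omega1 m (p k) <= C * q ^+ k) ->
  [/\ cL1 (@counting nat R) b & Dbeurling omega1 Omega
    (fun x => psi x * superpose (@counting nat R) b p x)].
Proof.
move=> bp; have [psiC psiN] := psiD.
have int m : 0 < m ->
    (\int[@counting nat R]_k (normc (b k) * wexp omega1 m (p k))%:E < +oo)%E.
  move=> /bp[C hC']; apply: (@counting_ge0_lty _ _ C) => k.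
  by rewrite hC' andbT mulr_ge0 ?normc_ge0 ?wexp_ge0.
have bL : cL1 (@counting nat R) b.
  split; first by split.
  apply: le_lt_trans (int 1 ltr01); apply: ge0_le_integral => //=.
  - by move=> k _; rewrite lee_fin normc_ge0.
  - move=> k _; rewrite lee_fin ler_peMr ?normc_ge0//.
    rewrite /wexp mul1r -[leLHS]expR0 ler_expR.
    by rewrite (weight_ge0 o1W)// euclid_ge0.
have mp i : measurable_fun [set: nat] (fun k => p k 0 i) by [].
split; first exact: bL.
split.
  apply: Cc_mul => //; apply: superpose_ccontinuous => //.
  have [C hC'] := weight_ge_ln o1W ler01; have [C' hC''] := bp 1 ltr01.
  apply: (@counting_ge0_lty _ _ (expR C * C')) => k.
  rewrite mulr_ge0 ?normc_ge0 ?euclid_ge0//=.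
  apply: (@le_trans _ _ (expR C * (normc (b k) * wexp omega1 1 (p k)))).
    rewrite mulrCA ler_wpM2l ?normc_ge0// /wexp -expRD.
    have e0 := euclid_ge0 (p k); have := hC' _ e0.
    rewrite !mul1r -ler_expR lnK ?posrE ?ltr_pwDl// [X in expR X]addrC.
    by apply: le_trans; rewrite lerDr.
  by rewrite -mulrA ler_wpM2l ?expR_ge0.
move=> l l0; have psiL := Cc_cL1row psiC; have lN := psiN l l0.
apply: le_lt_trans (fnorm_superpose bL mp o1W (ltW l0) psiL lN) _.
have fin0 : (0 <= fnorm omega1 l psi)%E.
  by apply: integral_ge0 => t _; rewrite lee_fin mulr_ge0 ?normc_ge0 ?expR_ge0.
have int0 : (0 <= \int[@counting nat R]_k (normc (b k) * wexp omega1 l (p k))%:E)%E.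
  by apply: integral_ge0 => t _; rewrite lee_fin mulr_ge0 ?normc_ge0 ?expR_ge0.
rewrite lte_mul_pinfty// lte_mul_pinfty//.
by rewrite ge0_fin_numE// int.
Qed.

(** The uniform boundedness principle for the functionals rho |-> <h_eps, rho>,
on characters localized by psi. Were the bound false for every n, say at eps_n
and xi_n, the gliding hump would produce a superposition of the psi e^{-i x.xi_n}
for which no l works. P is the real or the imaginary part. *)
Lemma fourier_part_bound (P : R[i] -> R) :
  (forall z, `|P z| <= normc z) -> (forall r z, P (r%:C%C * z) = r * P z) ->
  (forall g : nat -> R[i],
    P (cint (@counting nat R) g) = \int[@counting nat R]_k P (g k)) ->
  exists n : nat, \forall eps \near 0^'+, forall xi,
    `|P (a eps xi)| <=
    expR (n%:R * omega1 (euclid xi) - omega eps^-1 / n.+1%:R).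
Proof.
move=> Ple PZ PI; apply: contrapT => /forallNP hn.
have /choice[z hz] n := near0_violation (n.+1%:R ^+ 2)
  (ltac:(by rewrite invr_gt0) : 0 < n.+1%:R^-1 :> R) (hn n).
pose e n := (z n).1; pose xi n := (z n).2.
pose w n := omega (e n)^-1; pose v i := omega1 (euclid (xi i)).
have v0 i : 0 <= v i by rewrite (weight_ge0 o1W)// euclid_ge0.
(* The violated bound only gives e^{-w n / (n + 1)} on the diagonal: twice this
   exponent makes the diagonal unbounded, and it is still beaten by every fixed l
   as n grows. *)
pose E n := expR (2 * (w n / n.+1%:R)).
pose M n i := E n * (expR (- (i%:R / 2 * v i)) * P (a (e n) (xi i))).
have Mb n : exists B, forall i, `|M n i| <= B.
  have [e01 _ _ _] := hz n.
  have [B hB] := fourier_bounded (Cc_cL1row (hC e01)).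
  exists (E n * B) => i; rewrite normrM ger0_norm ?expR_ge0//.
  rewrite ler_wpM2l ?expR_ge0// normrM ger0_norm ?expR_ge0//.
  rewrite -[leRHS]mul1r; apply: ler_pM; rewrite ?expR_ge0//.
    by rewrite -[leRHS]expR0 ler_expR oppr_le0 mulr_ge0// divr_ge0.
  exact: le_trans (Ple _) (hB _).
have Mu A N : exists n i, (N <= n)%N /\ A < `|M n i|.
  pose n := maxn N (Num.bound `|A|); exists n, n; split; first exact: leq_maxl.
  have [_ _ wn] := hz n; move=> /negP; rewrite -ltNge -/(e n) -/(xi n) -/(w n) => hlt.
  rewrite normrM ger0_norm ?expR_ge0// normrM ger0_norm ?expR_ge0//.
  apply: (@lt_le_trans _ _ (E n * (expR (- (n%:R / 2 * v n)) *
      expR (n%:R * v n - w n / n.+1%:R)))); last first.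
    by rewrite !ler_wpM2l ?expR_ge0// ltW.
  have An : A < n.+1%:R.
    apply: le_lt_trans (ler_norm A) _.
    apply: lt_le_trans (archi_boundP (normr_ge0 A)) _.
    by rewrite ler_nat ltnW// ltnS leq_maxr.
  apply: (lt_le_trans An); apply: (@le_trans _ _ (expR n.+1%:R)).
    by apply: le_trans (expR_ge1Dx _); rewrite lerDr.
  rewrite -!expRD ler_expR.
  have nv : 0 <= n%:R * v n by rewrite mulr_ge0.
  have nw : n.+1%:R <= w n / n.+1%:R by rewrite ler_pdivlMr// -expr2.
  have -> : n%:R / 2 * v n = n%:R * v n / 2 by rewrite mulrAC.
  set X := n%:R * v n in nv *; set Y := w n / n.+1%:R in nw *.
  by move: nv nw; set Z := n.+1%:R; lra.
have [sg [ix [sg1 hump]]] := gliding_hump Mb Mu.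
pose c k : R := sg k * q ^+ k * expR (- ((ix k)%:R / 2 * v (ix k))).
pose b k : R[i] := (c k)%:C%C; pose p k := xi (ix k).
have cq k (s : R) : 0 <= s -> `|c k| * s <= expR (- ((ix k)%:R / 2 * v (ix k))) * s * q ^+ k.
  move=> s0; rewrite /c !normrM (ger0_norm (qk k)) (ger0_norm (expR_ge0 _)).
  rewrite [leRHS]mulrAC ler_wpM2r// [leRHS]mulrC ler_wpM2r ?expR_ge0//.
  by rewrite ler_piMl.
have bp m : 0 < m ->
    exists C, forall k, normc (b k) * wexp omega1 m (p k) <= C * q ^+ k.
  move=> m0; pose m2 := Num.bound (2 * m).
  have m2P : 2 * m < m2%:R by apply: archi_boundP; rewrite mulr_ge0// ltW.
  (* The indices ix k below 2 m may recur for infinitely many k; their finitely many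
   weights are bounded by the sum. *)
  exists (1 + \sum_(i < m2) expR (m * v i)) => k.
  rewrite normc_real; apply: le_trans (cq _ _ (wexp_ge0 _ _ _)) _.
  rewrite ler_wpM2r// /wexp -/(v _) -expRD; have [im|mi] := ltnP (ix k) m2.
    rewrite ler_wpDl// (bigD1 (Ordinal im))//= ler_wpDr ?sumr_ge0//.
    by rewrite ler_expR gerDr oppr_le0 mulr_ge0// divr_ge0.
  rewrite ler_wpDr ?sumr_ge0//.
  rewrite -[leRHS]expR0 ler_expR addrC -mulrBl mulr_le0_ge0// subr_le0.
  by rewrite ler_pdivlMr// mulrC (le_trans (ltW m2P))// ler_nat mi.
have [bL rhoD] := Dbeurling_superpose bp.
have [l l0 /(_ _ ltr01) /near0P[dl dl0 hl]] := h0 rhoD.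
pose N := (Num.bound dl^-1 + Num.bound (2 / l))%N.
have [n Nn] := hump N; apply/negP; rewrite -leNgt.
have [e01 en _ _] := hz n.
have [e_gt0 e_lt1] := andP e01.
have Nd : dl^-1 < n.+1%:R.
  apply: lt_le_trans (archi_boundP _) _; first by rewrite invr_ge0 ltW.
  by rewrite ler_nat (leq_trans _ (leqW Nn))// leq_addr.
have Nl : 2 / l < n.+1%:R.
  apply: lt_le_trans (archi_boundP _) _; first by rewrite divr_ge0// ltW.
  by rewrite ler_nat (leq_trans _ (leqW Nn))// leq_addl.
have edl : e n < dl.
  by apply: lt_trans en _; rewrite -[dl]invrK ltf_pV2 ?posrE ?invr_gt0.
have small := hl _ e_gt0 edl.
rewrite lee_fin mul1r ger0_norm ?normc_ge0// ger0_norm ?expR_ge0// -/(w n) in small.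
have w0 : 0 <= w n by rewrite (weight_ge0 oW)// invr_ge0 ltW.
set rho := (fun x => _) in rhoD small.
have fL := Cc_cL1row (hC e01).
have pairE : pairing (h (e n)) rho =
    cint (@counting nat R) (fun k => b k * a (e n) (p k)).
  transitivity (cint (@counting nat R) (fun k => b k * a (e n) (0 + p k))).
    rewrite -(fourier_superpose bL _ 0 fL)// fourier0 /pairing; congr cintegral.
    by apply/funext => x; rewrite /rho mulrCA mulrA.
  by apply: eq_cint => k; rewrite add0r.
have sumE k : sg k * q ^+ k * M n (ix k) = E n * P (b k * a (e n) (p k)).
  by rewrite PZ /M /c -/(p k); ring.
have [B hB] := fourier_bounded fL.
have iP : (@counting nat R).-integrable setT
    (EFin \o (fun k => P (b k * a (e n) (p k)))).
  apply: (@counting_integrable _ _ B) => k; rewrite PZ normrM.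
  apply: le_trans (cq _ _ (normr_ge0 _)) _; rewrite ler_wpM2r//.
  rewrite -[leRHS]mul1r; apply: ler_pM; rewrite ?expR_ge0//.
    by rewrite -[leRHS]expR0 ler_expR oppr_le0 mulr_ge0// divr_ge0.
  exact: le_trans (Ple _) (hB _).
rewrite (eq_Rintegral _ (fun k _ => sumE k)) RintegralZl// -PI -pairE.
rewrite normrM ger0_norm ?expR_ge0//.
apply: (@le_trans _ _ (E n * expR (- (l * w n)))).
  by rewrite ler_wpM2l ?expR_ge0// (le_trans (Ple _)).
rewrite /E -expRD -[leRHS]expR0 ler_expR mulrCA (mulrC l) -mulrBr mulr_ge0_le0// subr_le0.
rewrite ler_pdivrMr// mulrC -ler_pdivrMr//; exact: ltW.
Qed.

(** The real and the imaginary part have bounds with different n; both weaken to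
the larger one. *)
Lemma fourier_uniform_bound :
  exists n : nat, \forall eps \near 0^'+, forall xi,
    normc (a eps xi) <=
    2 * expR (n%:R * omega1 (euclid xi) - omega eps^-1 / n.+1%:R).
Proof.
have [n1 h1] := fourier_part_bound (@Re_le_normc R)
  (fun r z => ltac:(by case: z => ? ?; rewrite /= mul0r subr0)) (fun _ => erefl).
have [n2 h2] := fourier_part_bound (@Im_le_normc R)
  (fun r z => ltac:(by case: z => ? ?; rewrite /= mul0r addr0)) (fun _ => erefl).
have mono m n (eps : R) (xi : 'rV[R]_d) : (m <= n)%N -> 0 < eps ->
   expR (m%:R * omega1 (euclid xi) - omega eps^-1 / m.+1%:R) <=
   expR (n%:R * omega1 (euclid xi) - omega eps^-1 / n.+1%:R).
  move=> mn e0; rewrite ler_expR lerB//.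
    by rewrite ler_wpM2r ?ler_nat// (weight_ge0 o1W)// euclid_ge0.
  rewrite ler_wpM2l ?(weight_ge0 oW) ?invr_ge0 ?(ltW e0)//.
  by rewrite lef_pV2 ?posrE// ler_nat.
exists (maxn n1 n2); near=> eps => xi.
have e0 : 0 < eps by near: eps; exact: nbhs_right_gt.
apply: le_trans (normc_le_add _) _; rewrite mulr_natl mulr2n; apply: lerD.
  apply: (le_trans _ (mono n1 _ eps xi (leq_maxl n1 n2) e0)).
  by move: xi; near: eps.
apply: (le_trans _ (mono n2 _ eps xi (leq_maxr n1 n2) e0)).
by move: xi; near: eps.
Unshelve. all: by end_near. Qed.

End uniform_bound.

(** * Comparison of norms and the theorem *)

Section weighted_norms.
Context {R : realType} {d : nat}.
Local Notation normc := Normc.normc.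
Local Notation lam := (@lebesgue_tuple R d).
Implicit Types (f g : 'rV[R]_d -> R[i]) (Omega K : set 'rV[R]_d).

Lemma fnorm_ge0 sigma l f : (0 <= fnorm sigma l f)%E.
Proof. by apply: integral_ge0 => t _; rewrite lee_fin mulr_ge0 ?normc_ge0 ?expR_ge0. Qed.

Lemma measurable_normc_fourier f : cL1row f ->
  measurable_fun setT (fun t => normc (fourier f (@row_of_tuple R d t))).
Proof.
move=> fL; apply: cmeas_normc; apply: cmeas_fourier => // i.
exact: measurable_row_of_tuple.
Qed.

Lemma fnorm_nd sigma l1 l2 f : weight sigma -> cL1row f -> l1 <= l2 ->
  (fnorm sigma l1 f <= fnorm sigma l2 f)%E.
Proof.
move=> sW fL l12; have mF := measurable_normc_fourier fL.
have mw l := measurable_wexp sW l (@measurable_row_of_tuple R d).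
apply: ge0_le_integral => //=.
- by move=> t _; rewrite lee_fin mulr_ge0 ?normc_ge0 ?expR_ge0.
- by apply/measurable_EFinP; exact: measurable_funM (mw l1).
- by apply/measurable_EFinP; exact: measurable_funM (mw l2).
- by move=> t _; rewrite lee_fin ler_wpM2l ?normc_ge0//; exact: wexp_nd.
Qed.

(** The cutoff functions that moderateness provides are of class omega; this makes
them test functions for omega1, so that none has to be constructed. *)
Lemma Droumieu_Dbeurling omega omega1 Omega f : weight omega -> weight omega1 ->
  weight_ll omega1 omega -> Droumieu omega Omega f -> Dbeurling omega1 Omega f.
Proof.
move=> oW o1W ll [fC [l l0 fl]]; split; first exact: fC.
move=> m m0.
have fL := Cc_cL1row fC; have mF := measurable_normc_fourier fL.
have lm : 0 < l / m by rewrite divr_gt0.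
have [C hC] := weight_ll_le oW o1W ll lm.
apply: (@le_lt_trans _ _ ((expR (m * C))%:E * fnorm omega l f)%E); last first.
  by rewrite lte_mul_pinfty// lee_fin expR_ge0.
rewrite -ge0_integralZl//=; last 2 first.
- apply/measurable_EFinP; apply: measurable_funM => //.
  exact: (measurable_wexp oW l (@measurable_row_of_tuple R d)).
- by move=> t _; rewrite lee_fin mulr_ge0 ?normc_ge0 ?expR_ge0.
apply: ge0_le_integral => //=.
- by move=> t _; rewrite lee_fin mulr_ge0 ?normc_ge0 ?expR_ge0.
- apply/measurable_EFinP; apply: measurable_funM => //.
  exact: (measurable_wexp o1W m (@measurable_row_of_tuple R d)).
- apply: measurable_funeM; apply/measurable_EFinP; apply: measurable_funM => //.
  exact: (measurable_wexp oW l (@measurable_row_of_tuple R d)).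
move=> t _; rewrite -EFinM lee_fin mulrCA ler_wpM2l ?normc_ge0// -expRD ler_expR.
have := hC _ (euclid_ge0 (row_of_tuple t)); set e := euclid _ => h.
have : m * omega1 e <= m * (l / m * omega e + C) by rewrite ler_wpM2l ?(ltW m0).
rewrite mulrDr; have -> : m * (l / m * omega e) = l * omega e.
  by field; rewrite gt_eqF.
by rewrite addrC.
Qed.

(** Interpolation: if the Fourier transform of f is small up to a factor that
grows like e^{n omega1}, then the norm of exponent l / 4 of f is small as soon as
its norm of exponent l is not too large; tau balances the two terms. *)
Lemma fnorm_interpolation omega omega1 (n l A tau : R) f :
  weight omega -> weight omega1 -> weight_ll omega1 omega -> 0 < l -> 0 <= n ->
  0 <= A -> cL1row f ->
  (forall xi, normc (fourier f xi) <= A * expR (n * omega1 (euclid xi))) ->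
  (fnorm omega (l / 4) f <= (expR (- tau))%:E * fnorm omega l f +
     (expR tau * A)%:E *
     \int[lam]_t (wexp omega (- (l / 2)) (row_of_tuple t) *
                  wexp omega1 n (row_of_tuple t))%:E)%E.
Proof.
move=> oW o1W ll l0 n0 A0 fL fA; have mF := measurable_normc_fourier fL.
have mw s := measurable_wexp oW s (@measurable_row_of_tuple R d).
have mw1 s := measurable_wexp o1W s (@measurable_row_of_tuple R d).
rewrite -ge0_integralZl//=; last 2 first.
- by apply/measurable_EFinP; exact: measurable_funM (mw l).
- by move=> t _; rewrite lee_fin mulr_ge0 ?normc_ge0 ?expR_ge0.
rewrite -ge0_integralZl//=; last 3 first.
- by apply/measurable_EFinP; exact: measurable_funM (mw _) (mw1 n).
- by move=> t _; rewrite lee_fin mulr_ge0 ?expR_ge0.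
- by rewrite lee_fin mulr_ge0 ?expR_ge0.
rewrite -ge0_integralD//=; last 4 first.
- by move=> t _; rewrite -EFinM lee_fin !mulr_ge0 ?normc_ge0 ?expR_ge0.
- by apply: measurable_funeM; apply/measurable_EFinP; exact: measurable_funM (mw l).
- by move=> t _; rewrite -EFinM lee_fin !mulr_ge0 ?expR_ge0.
- by apply: measurable_funeM; apply/measurable_EFinP; exact: measurable_funM (mw _) (mw1 n).
apply: ge0_le_integral => //=.
- by move=> t _; rewrite lee_fin mulr_ge0 ?normc_ge0 ?expR_ge0.
- by apply/measurable_EFinP; exact: measurable_funM (mw _).
- apply: emeasurable_funD; apply: measurable_funeM; apply/measurable_EFinP.
    exact: measurable_funM (mw l).
  exact: measurable_funM (mw _) (mw1 n).
move=> t _; rewrite -!EFinM -EFinD lee_fin.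
set u := normc _; set x := row_of_tuple t.
have u0 : 0 <= u by exact: normc_ge0.
have uA : u <= A * wexp omega1 n x by exact: fA.
rewrite -/(wexp omega (l / 4) x) -/(wexp omega l x).
apply: (@le_trans _ _ (u * (expR (- tau) * wexp omega l x +
    expR tau * wexp omega (- (l / 2)) x))).
  rewrite ler_wpM2l// /wexp -!expRD; set o := omega _.
  have [h|h] := leP (- tau + l * o) (tau + - (l / 2) * o).
    by rewrite ler_wpDl ?expR_ge0// ler_expR; move: h; rewrite !mulNr; lra.
  by rewrite ler_wpDr ?expR_ge0// ler_expR; move: h; rewrite !mulNr; lra.
rewrite mulrDr; apply: lerD; first by rewrite mulrCA.
rewrite [leRHS](_ : _ = (expR tau * wexp omega (- (l / 2)) x) *
  (A * wexp omega1 n x)); last by ring.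
by rewrite mulrC ler_wpM2l// mulr_ge0 ?expR_ge0.
Qed.

End weighted_norms.

Theorem theorem8p3 (R : realType) (d : nat) (Omega : set 'rV[R]_d)
  (omega : R -> R) (h : R -> 'rV[R]_d -> R[i]) :
  open Omega -> weight omega -> moderate omega Omega h ->
  (exists omega1 : R -> R, [/\ weight omega1, weight_ll omega1 omega &
     forall rho : 'rV[R]_d -> R[i], Dbeurling omega1 Omega rho ->
       cnet_zero omega (fun eps => pairing (h eps) rho)]) ->
  Geq omega Omega h (fun _ _ => 0).
Proof.
move=> _ oW [hE hM] [omega1 [w1W o1ll hrho]].
rewrite /Geq.
have -> : (fun (eps : R) (x : 'rV[R]_d) => h eps x - 0) = h.
  by apply/funext => eps; apply/funext => x; rewrite subr0.
split=> // K cK KO.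
have fin_fnorm_on L l c eps : (`|fnorm_on omega Omega L l (h eps)| <= c%:E)%E ->
    exists psi, [/\ Droumieu omega Omega psi, forall x, L x -> psi x = 1 &
      (fnorm omega l (fun x => (psi x * h eps x)%R) < (c + 1)%:E)%E].
  move=> hc; have : (fnorm_on omega Omega L l (h eps) < (c + 1)%:E)%E.
    apply: (@le_lt_trans _ _ c%:E); last by rewrite lte_fin ltrDl.
    by apply: le_trans hc; exact: lee_abs.
  by case/ereal_inf_lt => _ [psi [psiD psiL] <-] lt; exists psi.
have [l0 l00 /(_ _ ltr01) /near0P[d0 d00 hd0]] := hM K cK KO 1 ltr01.
(* A finite infimum at a single eps0 provides the cutoff function psi. *)
pose eps0 := Num.min d0 1 / 2.
have m0 : 0 < Num.min d0 1 by rewrite lt_min d00 ltr01.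
have eps0_lt : eps0 < Num.min d0 1 by rewrite ltr_pdivrMr// ltr_pMr// ltr1n.
have eps0_gt0 : 0 < eps0 by rewrite divr_gt0.
have eps0_d0 : eps0 < d0 by move: eps0_lt; rewrite lt_min => /andP[].
have [psi [psiR psiK _]] := fin_fnorm_on _ _ _ _ (hd0 eps0 eps0_gt0 eps0_d0).
have psiD := Droumieu_Dbeurling oW w1W o1ll psiR.
have [psiC [lpsi lpsi0 psil]] := psiR.
have psiL := Cc_cL1row psiC.
have hC eps : 0 < eps < 1 -> Cc Omega (fun x => psi x * h eps x).
  by move=> /hE[_ /(_ _ psiR)][].
have [n /near0P[d1 d10 bound]] := fourier_uniform_bound oW w1W psiD hC hrho.
pose l : R := n.+1%:R^-1.
have lgt0 : 0 < l by rewrite invr_gt0.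
have [_ psiKc psiKO] := psiC.
have l20 : 0 < l / 2 by rewrite divr_gt0.
have [h1 h10 /(_ _ ltr01) /near0P[d2 d20 hd2]] := hM (csupport psi) psiKc psiKO _ l20.
pose h2 := Num.min h1 lpsi.
have h20 : 0 < h2 by rewrite lt_min h10 lpsi0.
have psih2 : (fnorm omega h2 psi < +oo)%E.
  by apply: le_lt_trans psil; apply: fnorm_nd => //; rewrite ge_min lexx orbT.
have [c c0 mulc] := fnorm_mul oW (ltW h20) psiC psih2.
have J : (\int[lebesgue_tuple d]_t (wexp omega (- (h2 / 2)) (row_of_tuple t) *
    wexp omega1 n%:R (row_of_tuple t))%:E < +oo)%E.
  by apply: integral_wexp_lty => //; rewrite divr_gt0.
set I := integral _ _ _ in J.
have I0 : (0 <= I)%E by apply: integral_ge0 => t _; rewrite lee_fin mulr_ge0 ?wexp_ge0.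
have IE : I = (fine I)%:E by rewrite fineK// ge0_fin_numE.
pose C := 2 * c + 2 * fine I.
have fI0 : 0 <= fine I by exact: fine_ge0.
exists (l / 8); first by rewrite divr_gt0.
exists (h2 / 4); first by rewrite divr_gt0.
move=> c1 c10.
have main eps : 0 < eps -> eps < d1 -> eps < d2 -> eps < 1 ->
  (fnorm omega (h2 / 4) (fun x => psi x * h eps x)%R <=
    (C * expR (- (l / 4 * omega eps^-1)))%:E)%E.
  move=> e0 e1 e2 elt1; have e01 : 0 < eps < 1 by rewrite e0.
  set w := omega eps^-1.
  have w0 : 0 <= w by rewrite (weight_ge0 oW)// invr_ge0 ltW.
  (* The cutoff psi2 depends on eps, but psi does not, and psi2 = 1 where psi lives. *)
  have [psi2 [psi2R psi21 psi2h]] := fin_fnorm_on _ _ _ _ (hd2 _ e0 e2).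
  have gC : Cc Omega (fun x => psi2 x * h eps x).
    by have [_ /(_ _ psi2R)[]] := hE eps e01.
  have gL := Cc_cL1row gC.
  have fL := Cc_cL1row (hC _ e01).
  rewrite mul1r ger0_norm ?expR_ge0// -/w in psi2h.
  have g2 : (fnorm omega h2 (fun x => (psi2 x * h eps x)%R) <=
      (2 * expR (l / 2 * w))%:E)%E.
    apply: (@le_trans _ _ (fnorm omega h1 (fun x => (psi2 x * h eps x)%R))).
      by apply: fnorm_nd => //; rewrite ge_min lexx.
    apply: le_trans (ltW psi2h) _; rewrite lee_fin mulr_natl mulr2n lerD2l.
    by rewrite -[leLHS]expR0 ler_expR mulr_ge0// ltW.
  have f2 : (fnorm omega h2 (fun x => (psi x * h eps x)%R) <=
      (c * (2 * expR (l / 2 * w)))%:E)%E.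
    rewrite (_ : (fun x => _) = (fun x => psi x * (psi2 x * h eps x))).
      apply: le_trans (mulc _ gL _) _; first by apply: le_lt_trans g2 _; exact: ltry.
      by rewrite EFinM lee_wpmul2l.
    apply/funext => x; have [Kx|nKx] := pselect (csupport psi x).
      by rewrite psi21// mul1r.
    by rewrite (csupport_out nKx) !mul0r.
  have fA xi : Normc.normc (fourier (fun x => psi x * h eps x) xi) <=
      2 * expR (- (l * w)) * expR (n%:R * omega1 (euclid xi)).
    by rewrite -mulrA -expRD addrC (mulrC l); exact: bound.
  (* With this tau both terms of the interpolation are of order e^{-(l/4) w}. *)
  pose tau := 3 / 4 * l * w.
  have A0 : 0 <= 2 * expR (- (l * w)) by rewrite mulr_ge0 ?expR_ge0.
  apply: le_trans (fnorm_interpolation tau oW w1W o1ll h20 (ler0n _ n) A0 fL fA) _.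
  rewrite -/I IE -EFinM.
  apply: (@le_trans _ _ ((expR (- tau) * (c * (2 * expR (l / 2 * w)))) +
     expR tau * (2 * expR (- (l * w))) * fine I)%:E).
    rewrite EFinD; apply: leeD => //.
    by rewrite [leRHS]EFinM lee_wpmul2l// lee_fin expR_ge0.
  rewrite lee_fin /C [leRHS]mulrDl.
  have -> : expR (- tau) * (c * (2 * expR (l / 2 * w))) =
      2 * c * expR (- (l / 4 * w)).
    have -> : - (l / 4 * w) = - tau + l / 2 * w by rewrite /tau; field.
    by rewrite expRD; ring.
  have -> : expR tau * (2 * expR (- (l * w))) * fine I =
      2 * fine I * expR (- (l / 4 * w)).
    have -> : - (l / 4 * w) = tau - l * w by rewrite /tau; field.
    by rewrite expRD; ring.
  by [].
near=> eps.
have e0 : 0 < eps by near: eps; exact: nbhs_right_gt.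
have e1 : eps < d1 by near: eps; apply: nbhs_right_lt.
have e2 : eps < d2 by near: eps; apply: nbhs_right_lt.
have elt1 : eps < 1 by near: eps; apply: nbhs_right_lt.
have wA : 8 / l * (C / c1) <= omega eps^-1 by near: eps; exact: weight_near0_ge.
rewrite gee0_abs; last first.
  by apply: le_ereal_inf_tmp => _ [phi _ <-]; exact: fnorm_ge0.
apply: (@le_trans _ _ (fnorm omega (h2 / 4) (fun x => psi x * h eps x))).
  by apply: ereal_inf_lbound; exists psi.
apply: le_trans (main eps e0 e1 e2 elt1) _; rewrite lee_fin.
rewrite ger0_norm ?expR_ge0//; set w := omega _ in wA *.
have -> : - (l / 4 * w) = - (l / 8 * w) + - (l / 8 * w) by field.
rewrite expRD mulrA ler_wpM2r ?expR_ge0// expRN ler_pdivrMr ?expR_gt0//.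
rewrite mulrC -ler_pdivrMr//.
apply: (@le_trans _ _ (l / 8 * w)); last first.
  by apply: le_trans (expR_ge1Dx _); rewrite lerDr.
by rewrite -ler_pdivrMl ?divr_gt0// invf_div.
Unshelve. all: by end_near. Qed.
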